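(* Let $D\subset\mathbb{R}^d$ be a measurable set, let $\varrho_D$ be a measure on $D$, and let $H(K)$ be a separable, infinite-dimensional reproducing kernel Hilbert space of complex-valued functions on $D$ with a positive semidefinite (Hermitian) kernel $K:D\times D\to\mathbb{C}$ satisfying $$\int_D K(\mathbf{x},\mathbf{x})\,d\varrho_D(\mathbf{x})<\infty .$$ Let $(\sigma_k)_{k=1}^\infty$ be the singular numbers of the embedding $\mathrm{Id}_{K,\varrho_D}:H(K)\to L_2(D,\varrho_D)$ and let $g_m:=g_m(\mathrm{Id}_{K,\varrho_D})$ be the sampling numbers. Then for all integers $m\geq 13136$, $$g_m^2\;\leq\; C\,\frac{\log m}{m}\sum_{k\geq cm}\sigma_k^2\qquad\text{with } C=1.5\cdot 10^{6}\ \text{ and }\ c=3.8\cdot 10^{-5}.$$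
   Context: $L_2(D,\varrho_D)$ is the space of (equivalence classes of) complex-valued functions on $D$ that are square-integrable with respect to $\varrho_D$. $\mathrm{Id}_{K,\varrho_D}:H(K)\to L_2(D,\varrho_D)$ maps a function to its equivalence class (it need not be injective). Singular numbers: let $\lambda_1\geq\lambda_2\geq\cdots>0$ be the (at most countable) system of strictly positive eigenvalues, counted with multiplicity and arranged in non-increasing order, of $W_{K,\varrho_D}=\mathrm{Id}_{K,\varrho_D}^{*}\circ\mathrm{Id}_{K,\varrho_D}$; then $\sigma_k:=\sqrt{\lambda_k}$ (with $\sigma_k:=0$ if there are fewer than $k$ positive eigenvalues). The sum $\sum_{k\ge cm}$ runs over natural numbers $k\geq 1$ with $k\ge cm$. Sampling numbers: $$g_m(\mathrm{Id}_{K,\varrho_D}) := \inf_{\mathbf{x}^1,\dots,\mathbf{x}^m\in D}\ \inf_{\varphi:\mathbb{C}^m\to L_2(D,\varrho_D)}\ \sup_{\|f\|_{H(K)}\leq 1}\big\|f-\varphi(f(\mathbf{x}^1),\dots,f(\mathbf{x}^m))\big\|_{L_2(D,\varrho_D)},$$ where $\varphi$ ranges over all maps. $\log$ is the natural logarithm. *)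

(* Defs.v *)
From HB Require Import structures.
From mathcomp Require Import all_boot all_order all_algebra.
From mathcomp Require Import all_classical all_reals all_analysis.
From mathcomp Require Import complex.

Set Implicit Arguments.
Unset Strict Implicit.
Unset Printing Implicit Defensive.

Import Order.TTheory GRing.Theory Num.Theory numFieldNormedType.Exports.

Local Open Scope classical_set_scope.
Local Open Scope ring_scope.

Section Kernels.
Variables (R : realType) (T : Type) (D : set T) (K : T -> T -> R[i]).

(* Functions on D are functions on the ambient type T of which only the values
   on D are ever used.  In R[i], [0 <= z] means that z is real and nonnegative. *)
Definition psd_kernel : Prop :=
  (forall x y, D x -> D y -> K x y = (K y x)^*) /\
  (forall (n : nat) (x : 'I_n -> T) (c : 'I_n -> R[i]),
    (forall i, D (x i)) ->
    0 <= \sum_(i < n) \sum_(j < n) c i * (c j)^* * K (x i) (x j)).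

(* [rkhs H] presents the Hilbert space H as the reproducing kernel Hilbert
   space H(K): a complete normed space over R[i] whose norm comes from an inner
   product (linear in its first argument), whose elements are functions on D by
   way of [rkhs_eval] (linear, and two elements that agree on D are equal), and
   such that [rkhs_section y] is the function K(., y) and reproduces the value
   at y. *)
Record rkhs (H : completeNormedModType R[i]) := Rkhs {
  rkhs_inner : {dot H for Num.conj};
  rkhs_normE : forall f : H, `|f| ^+ 2 = rkhs_inner f f;
  rkhs_eval : H -> T -> R[i];
  rkhs_eval_linear : forall (a : R[i]) (f g : H) x, D x ->
    rkhs_eval (a *: f + g) x = a * rkhs_eval f x + rkhs_eval g x;
  rkhs_eval_inj : forall f g : H,
    (forall x, D x -> rkhs_eval f x = rkhs_eval g x) -> f = g;
  rkhs_section : T -> H;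
  rkhs_sectionE : forall x y, D x -> D y ->
    rkhs_eval (rkhs_section y) x = K x y;
  rkhs_reproducing : forall (f : H) y, D y ->
    rkhs_eval f y = rkhs_inner f (rkhs_section y)
}.

End Kernels.

Section Dimension.
Variables (F : fieldType) (V : lmodType F).

Definition lin_indep (n : nat) (v : 'I_n -> V) : Prop :=
  forall c : 'I_n -> F, \sum_(i < n) c i *: v i = 0 -> forall i, c i = 0.

Definition infinite_dimensional : Prop :=
  forall n : nat, exists v : 'I_n -> V, lin_indep v.

Definition has_dim (E : set V) (n : nat) : Prop :=
  exists2 v : 'I_n -> V, lin_indep v &
    E = [set w | exists c : 'I_n -> F, w = \sum_(i < n) c i *: v i].

End Dimension.

Definition separable (X : topologicalType) : Prop :=
  exists2 S : set X, countable S & dense S.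

(* The space L_2(D, mu) of complex-valued functions.  A class is handled through
   its representatives: the inner product and the norm below do not distinguish
   functions that agree mu-almost everywhere on D. *)
Section L2.
Context {d : measure_display} {T : measurableType d} {R : realType}.
Variables (mu : {measure set T -> \bar R}) (D : set T).

Definition cmeasurable (f : T -> R[i]) : Prop :=
  measurable_fun D (fun t => complex.Re (f t)) /\
  measurable_fun D (fun t => complex.Im (f t)).

Definition L2_norm (f : T -> R[i]) : \bar R :=
  sqrte (\int[mu]_(t in D) (Normc.normc (f t) ^+ 2)%:E)%E.

Definition L2 : set (T -> R[i]) :=
  [set f | cmeasurable f /\ (L2_norm f < +oo)%E].

Definition L2_inner (f g : T -> R[i]) : R[i] :=
  Complex (\int[mu]_(t in D) complex.Re (f t * (g t)^*))
          (\int[mu]_(t in D) complex.Im (f t * (g t)^*)).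

End L2.

(* The positive eigenvalues of W, with multiplicity, in non-increasing order,
   are [lam 1, lam 2, ...], continued by zeros if there are only finitely many
   of them; [lam 0] is irrelevant. Every t > 0 occurs exactly as many times in
   this list as the dimension of the kernel of W - t, which is 0 when t is not
   an eigenvalue. *)
Definition positive_eigenvalues (R : realType) (H : lmodType R[i])
    (W : H -> H) (lam : nat -> R) : Prop :=
  [/\ forall k, (1 <= k)%N -> 0 <= lam k,
      forall j k, (1 <= j <= k)%N -> lam k <= lam j &
      forall t : R, 0 < t -> exists2 n : nat,
        has_dim [set f | W f = (real_complex R t) *: f] n &
        ([set k | (1 <= k)%N /\ lam k = t] #= `I_n)%card].

Section Embedding.
Context {d : measure_display} {T : measurableType d} {R : realType}.
Variables (mu : {measure set T -> \bar R}) (D : set T) (K : T -> T -> R[i]).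
Variables (H : completeNormedModType R[i]) (HK : rkhs D K H).

(* The embedding Id of H(K) into L_2(D, mu). *)
Definition Id_rkhs : H -> T -> R[i] := rkhs_eval HK.

Definition is_adjoint_Id (A : (T -> R[i]) -> H) : Prop :=
  forall u (f : H), L2 mu D u ->
    rkhs_inner HK (A u) f = L2_inner mu D u (Id_rkhs f).

Definition singular_numbers (sigma : nat -> R) : Prop :=
  exists (Idstar : (T -> R[i]) -> H) (lam : nat -> R),
    [/\ is_adjoint_Id Idstar,
        positive_eigenvalues (Idstar \o Id_rkhs) lam &
        forall k, (1 <= k)%N -> sigma k = Num.sqrt (lam k)].

Definition worst_case_error (m : nat) (x : 'I_m -> T)
    (phi : 'rV[R[i]]_m -> T -> R[i]) : \bar R :=
  ereal_sup [set L2_norm mu D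
                   (fun t => Id_rkhs f t - phi (\row_i rkhs_eval HK f (x i)) t)
            | f in [set f : H | `|f| <= 1]].

Definition sampling_number (m : nat) : \bar R :=
  ereal_inf
    [set ereal_inf [set worst_case_error x phi
                   | phi in [set phi | forall v, L2 mu D (phi v)]]
    | x in [set x : 'I_m -> T | forall i, D (x i)]].

End Embedding.

(* Main.v *)
(* Let e_0, e_1, ... be the eigenvectors of W = Id^* Id with eigenvalues
   lam_0 >= lam_1 >= ..., and let eta(x) be the vector with entries
   e_j(x) / sqrt(lam_j), so that the integral of eta(x) eta(x)^* is the identity.
   The lower barrier argument of Batson, Spielman and Srivastava selects points
   x_i and weights s_i greedily: starting from X = diag(b / lam_j + z [j < n]),
   each step replaces X by X - 1 + s eta(x) eta(x)^* without increasing the trace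
   of the inverse of X beyond 1/4; averaging over the measure shows that a
   suitable x always exists.  After m steps the matrix is still positive, so a
   function f of the unit ball that vanishes at all the points satisfies
   (m - z) |f|^2 <= b in L_2.  The initial trace is at most n / z + t / b, where
   t is the sum of the lam_j with j >= n, so z = 8 n and b = 8 t are admissible.
   With n = m / 16 this gives g_m^2 <= 64 t / m, since two functions of the unit
   ball with the same samples differ by twice such an f.  The infinite system
   is truncated where the remaining trace is at most eps; the discarded part is
   controlled by making its pointwise norm part of the cost of a point. *)
Require Import Defs.
From HB Require Import structures.
From mathcomp Require Import all_boot all_order all_algebra.
From mathcomp Require Import all_classical all_reals all_analysis.
From mathcomp Require Import complex measurable_realfun ring lra.

Set Implicit Arguments.
Unset Strict Implicit.
Unset Printing Implicit Defensive.

Import Order.TTheory GRing.Theory Num.Theory numFieldNormedType.Exports.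

Local Open Scope classical_set_scope.
Local Open Scope ring_scope.

(** * Lower barrier argument *)

Section ComplexSquare.
Variable R : realType.
Implicit Types (z w : R[i]) (a b : R).

(** Real-valued, unlike [z * z^*], so that estimates and integrals stay in [R]; [sqnC] leads back to
    [R[i]]. *)
Definition sqn z : R := Normc.normc z ^+ 2.

Lemma sqnE z : sqn z = complex.Re z ^+ 2 + complex.Im z ^+ 2.
Proof.
by case: z => a b; rewrite /sqn /= sqr_sqrtr // addr_ge0 // sqr_ge0.
Qed.

Lemma sqnC z : real_complex R (sqn z) = z * z^*.
Proof. by rewrite -sqr_normc normc_def sqnE -rmorphXn /= sqr_sqrtr // addr_ge0 // sqr_ge0. Qed.

Lemma sqn_ge0 z : 0 <= sqn z.
Proof. exact: sqr_ge0. Qed.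

Lemma sqnM z w : sqn (z * w) = sqn z * sqn w.
Proof. by rewrite /sqn Normc.normcM exprMn. Qed.

Lemma sqn_conj z : sqn z^* = sqn z.
Proof. by case: z => a b; rewrite !sqnE /= sqrrN. Qed.

Lemma sqn_real a : sqn (real_complex R a) = a ^+ 2.
Proof. by rewrite sqnE /= expr0n /= addr0. Qed.

Lemma sqn0 : sqn 0 = 0.
Proof. by rewrite (sqn_real 0) expr0n. Qed.

Lemma sqnN z : sqn (- z) = sqn z.
Proof. by case: z => a b; rewrite !sqnE /= !sqrrN. Qed.

Lemma sqn_eq0 z : (sqn z == 0) = (z == 0).
Proof.
rewrite -(inj_eq (@complexI R)) sqnC mulf_eq0 conjC_eq0.
by rewrite orbb.
Qed.

Lemma conj_realC a : (real_complex R a)^* = real_complex R a.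
Proof. exact: conjc_real. Qed.

End ComplexSquare.

Section LowerBarrier.
Variable R : realType.
Local Notation C := R[i].
Local Notation "a %:C" := (real_complex R a).
Local Open Scope sesquilinear_scope.

Definition mxform n (A : 'M[C]_n) (y : 'rV[C]_n) : C := (y *m A *m y ^t*) 0 0.

Definition rdiag n (l : 'I_n -> R) : 'M[C]_n := diag_mx (\row_i (l i)%:C).

Definition spectral_form n (P : 'M[C]_n) (l : 'I_n -> R) : 'M[C]_n :=
  P ^t* *m rdiag l *m P.

Lemma trmxC_mul m n p (A : 'M[C]_(m, n)) (B : 'M[C]_(n, p)) :
  (A *m B) ^t* = B ^t* *m A ^t*.
Proof. by rewrite trmx_mul map_mxM. Qed.

Lemma trmxCD m n (A B : 'M[C]_(m, n)) : (A + B) ^t* = A ^t* + B ^t*.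
Proof. by rewrite linearD map_mxD. Qed.

Lemma trmxCZ m n (a : R) (A : 'M[C]_(m, n)) : (a%:C *: A) ^t* = a%:C *: A ^t*.
Proof. by rewrite linearZ map_mxZ; congr (_ *: _); exact: conj_realC. Qed.

Lemma trmxC_rdiag n (l : 'I_n -> R) : (rdiag l) ^t* = rdiag l.
Proof.
rewrite /rdiag tr_diag_mx map_diag_mx; congr diag_mx.
by apply/rowP => i; rewrite !mxE; exact: conj_realC.
Qed.

Lemma mxform_rdiag n (l : 'I_n -> R) y :
  mxform (rdiag l) y = (\sum_i l i * sqn (y 0 i))%:C.
Proof.
rewrite /mxform /rdiag mxE rmorph_sum /=; apply: eq_bigr => i _.
by rewrite mul_mx_diag !mxE rmorphM /= sqnC mulrCA mulrA.
Qed.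

Lemma mxform_conj n (A P : 'M[C]_n) y :
  mxform (P ^t* *m A *m P) y = mxform A (y *m P ^t*).
Proof. by rewrite /mxform trmxC_mul trmxCK !mulmxA. Qed.

Lemma mxformD n (A B : 'M[C]_n) y : mxform (A + B) y = mxform A y + mxform B y.
Proof. by rewrite /mxform mulmxDr mulmxDl mxE. Qed.

Lemma mxformZ n (a : C) (A : 'M[C]_n) y : mxform (a *: A) y = a * mxform A y.
Proof. by rewrite /mxform -scalemxAr -scalemxAl mxE. Qed.

Lemma mxform1 n (y : 'rV[C]_n) : mxform 1%:M y = (\sum_i sqn (y 0 i))%:C.
Proof.
rewrite /mxform mulmx1 mxE rmorph_sum /=.
by apply: eq_bigr => i _; rewrite !mxE sqnC.
Qed.

Lemma mxform_rank1 n (v y : 'rV[C]_n) :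
  mxform (v ^t* *m v) y = (sqn ((y *m v ^t*) 0 0))%:C.
Proof.
rewrite /mxform mulmxA -[_ *m v *m _]mulmxA.
have -> : v *m y ^t* = (y *m v ^t*) ^t* by rewrite trmxC_mul trmxCK.
by rewrite mxE big_ord1 !mxE sqnC.
Qed.

Lemma spectral_formP n (A : 'M[C]_n) : A ^t* = A ->
  exists P l, P \is unitarymx /\ A = spectral_form P l.
Proof.
move=> hA.
have hermA : A \is hermsymmx.
  by apply/is_hermitianmxP; rewrite expr0 scale1r hA.
have realA := hermitian_spectral_diag_real hermA.
have /hermitian_normalmx/orthomx_spectralP := hermA.
rewrite invmx_unitary ?spectral_unitarymx // => eqA.
exists (spectralmx A), (fun i => complex.Re (spectral_diag A 0 i)).
split; first exact: spectral_unitarymx.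
rewrite /spectral_form /rdiag.
suff -> : \row_i (complex.Re (spectral_diag A 0 i))%:C = spectral_diag A.
  exact: eqA.
by apply/rowP => i; rewrite mxE RRe_real //; apply: (mxOverP realA).
Qed.

Lemma unitarymxC n (P : 'M[C]_n) : P \is unitarymx -> P ^t* *m P = 1%:M.
Proof. by move=> uP; rewrite -invmx_unitary // mulVmx // unitarymx_unit. Qed.

Lemma mxtrace_spectral n (P : 'M[C]_n) (A : 'M[C]_n) : P \is unitarymx ->
  \tr (P ^t* *m A *m P) = \tr A.
Proof.
by move=> uP; rewrite -mulmxA mxtrace_mulC -mulmxA (unitarymxP uP) mulmx1.
Qed.

Lemma mxtrace_rdiag n (l : 'I_n -> R) : \tr (rdiag l) = (\sum_i l i)%:C.
Proof.
by rewrite /rdiag mxtrace_diag rmorph_sum; apply: eq_bigr => i _; rewrite mxE.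
Qed.

Lemma rdiag_inv n (l : 'I_n -> R) : (forall i, l i != 0) ->
  rdiag l *m rdiag (fun i => (l i)^-1) = 1%:M.
Proof.
move=> l0; rewrite /rdiag mulmx_diag -diag_const_mx; congr diag_mx.
by apply/rowP => i; rewrite !mxE -rmorphM /= divff.
Qed.

(** Positive definiteness with trace of the inverse at most 1/4, read off the eigenvalues. The bound
    forces every eigenvalue to be at least 4, so subtracting the identity keeps the matrix
    positive. *)
Definition barrier n (X : 'M[C]_n) := exists P l,
  [/\ P \is unitarymx, X = spectral_form P l, forall i, 0 < l i &
      \sum_i (l i)^-1 <= 4^-1].

Lemma spectral_form_gt0 n (P : 'M[C]_n) l :
  P \is unitarymx ->
  (forall y, y != 0 -> 0 < mxform (spectral_form P l) y) ->
  forall i, 0 < l i.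
Proof.
move=> uP pos i.
(* This vector is row [i] of [P], an eigenvector for [l i]. *)
have := pos (delta_mx 0 i *m P).
rewrite mxform_conj -mulmxA (unitarymxP uP) mulmx1 mxform_rdiag.
rewrite (bigD1 i) //= !mxE !eqxx /= big1 => [|j /negPf ji]; last first.
  by rewrite mxE eqxx ji /= sqn0 mulr0.
rewrite (sqn_real 1) expr1n mulr1 addr0.
rewrite (@ltcR _ 0); apply.
apply/eqP => /(congr1 (mulmx^~ (P ^t*))).
rewrite -mulmxA (unitarymxP uP) mulmx1 mul0mx => /matrixP/(_ 0 i).
by rewrite !mxE !eqxx /= => /eqP; rewrite oner_eq0.
Qed.

(** A right inverse [Z] is the inverse, so it is diagonalized by the same [P], and its trace is the
    sum of the reciprocal eigenvalues. *)
Lemma barrier_inv n (X Z : 'M[C]_n) :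
  X ^t* = X -> (forall y, y != 0 -> 0 < mxform X y) ->
  X *m Z = 1%:M -> \tr Z <= (4^-1)%:C -> barrier X.
Proof.
move=> /spectral_formP [P [l [uP ->]]] /(spectral_form_gt0 uP) l0 XZ trZ.
exists P, l; split => //.
suff EZ : Z = spectral_form P (fun i => (l i)^-1).
  by move: trZ; rewrite EZ /spectral_form mxtrace_spectral // mxtrace_rdiag lecR.
have XY : spectral_form P l *m spectral_form P (fun i => (l i)^-1) = 1%:M.
  rewrite /spectral_form -!mulmxA [P *m (_ *m _)]mulmxA (unitarymxP uP) mul1mx.
  rewrite [rdiag _ *m (_ *m _)]mulmxA rdiag_inv ?mul1mx ?unitarymxC //.
  by move=> i; rewrite gt_eqF.
have := congr1 (mulmx (spectral_form P (fun i => (l i)^-1))) XZ.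
by rewrite mulmxA (mulmx1C XY) mul1mx mulmx1.
Qed.


(** The admissible weight of [v] is governed by a quadratic form in [v] that is diagonal in the
    eigenbasis of [X]. The lower bound on its trace [\sum_i l i] is what an average over isotropic
    vectors [v] can exploit. *)
Lemma barrier_step n (X : 'M[C]_n.+1) : barrier X ->
  exists (P : 'M[C]_n.+1) (l : 'I_n.+1 -> R),
  [/\ P \is unitarymx, 2^-1 <= \sum_i l i &
    forall (v : 'rV[C]_n.+1) a, a = \sum_i l i * sqn ((v *m P ^t*) 0 i) ->
      0 < a -> barrier (X - 1%:M + (a^-1)%:C *: (v ^t* *m v))].
Proof.
case=> P [p [uP -> p0 sp]].
have pi4 i : (p i)^-1 <= 4^-1.
  apply: le_trans sp; rewrite (bigD1 i) //= lerDl sumr_ge0 // => j _.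
  by rewrite invr_ge0 ltW.
have p4 i : 4 <= p i by rewrite -lef_pV2 ?posrE // pi4.
pose q i := p i - 1.
have q0 i : 0 < q i by rewrite /q; have := p4 i; lra.
pose Delta := \sum_i ((q i)^-1 - (p i)^-1).
have DeltaE i : (q i)^-1 - (p i)^-1 = (q i)^-1 * (p i)^-1.
  have := q0 i; have := p0 i; rewrite /q => h1 h2.
  by field; rewrite !gt_eqF.
have Delta_gt0 : 0 < Delta.
  rewrite /Delta big_ord_recl ltr_pwDl //.
    by rewrite DeltaE mulr_gt0 // invr_gt0.
  by apply: sumr_ge0 => i _; rewrite DeltaE mulr_ge0 // invr_ge0 ltW.
pose l i := (q i)^-2 / Delta - (q i)^-1.
(* By Sherman-Morrison, adding [s v^* v] to [X - 1] lowers the trace of the inverse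
   by [s gamma / (1 + s beta)]; it has to make up for [Delta], the effect of the
   shift, and this holds with equality for [1 / s = gamma / Delta - beta]. *)
exists P, l; split => //.
  rewrite /l sumrB -mulr_suml.
  have h1 : 1 <= (\sum_i (q i)^-2) / Delta.
    rewrite ler_pdivlMr // mul1r; apply: ler_sum => i _.
    rewrite DeltaE -exprVn expr2.
    apply: ler_wpM2l; first by rewrite invr_ge0 ltW.
    by rewrite lef_pV2 ?posrE // /q gerBl.
  (* From [p i >= 4] follows [q i >= 3/4 * p i], so this sum is at most 1/3; with [h1] the trace is
     at least 2/3. *)
  have h2 : \sum_i (q i)^-1 <= 4 / 3 * \sum_i (p i)^-1.
    rewrite mulr_sumr; apply: ler_sum => i _.
    have := q0 i; have := p4 i => h3 h4.
    have -> : 4 / 3 * (p i)^-1 = (3 / 4 * p i)^-1.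
      by field; rewrite gt_eqF.
    by rewrite lef_pV2 ?posrE // /q; lra.
  lra.
move=> v a aE a0.
set w := v *m P ^t* in aE.
pose s := a^-1.
have s0 : 0 < s by rewrite invr_gt0.
have vE : v = w *m P by rewrite /w -mulmxA unitarymxC // mulmx1.
clearbody w.
pose qi i := (q i)^-1.
pose u := w *m rdiag qi.
pose A := rdiag q + s%:C *: (w ^t* *m w).
have XE : spectral_form P p - 1%:M + s%:C *: (v ^t* *m v) = P ^t* *m A *m P.
  rewrite vE trmxC_mul /A mulmxDr mulmxDl -scalemxAr -scalemxAl !mulmxA.
  congr (_ + _).
  have -> : rdiag q = rdiag p - 1%:M.
    apply/matrixP => i j; rewrite !mxE -mulrnBl; congr (_ *+ _).
    by rewrite /q rmorphB rmorph1.
  by rewrite mulmxBr mulmxBl mulmx1 unitarymxC.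
rewrite -/s XE.
pose beta := \sum_i qi i * sqn (w 0 i).
pose gamma := \sum_i (qi i) ^+ 2 * sqn (w 0 i).
have aE2 : a = gamma / Delta - beta.
  rewrite aE /gamma mulr_suml /beta -sumrB; apply: eq_bigr => i _.
  by rewrite /l mulrBl /qi exprVn; ring.
have beta0 : 0 <= beta.
  by apply: sumr_ge0 => i _; rewrite mulr_ge0 ?sqn_ge0 // /qi invr_ge0 ltW.
have sb0 : 0 < 1 + s * beta by rewrite ltr_pwDl // mulr_ge0 // ltW.
pose c := s / (1 + s * beta).
(* The Sherman-Morrison inverse of [A], verified in [AZ]. *)
pose Z := rdiag qi - c%:C *: (u ^t* *m u).
have uE : u ^t* = rdiag qi *m w ^t* by rewrite trmxC_mul trmxC_rdiag.
have ui i : u 0 i = w 0 i * (qi i)%:C by rewrite /u /rdiag mul_mx_diag !mxE.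
have uw : w *m rdiag qi = u by [].
clearbody u.
have wu : w *m u ^t* = (beta%:C)%:M.
  rewrite uE; apply/matrixP => i j; rewrite !ord1.
  rewrite mulmxA -/(mxform _ _) mxE eqxx mulr1n.
  by rewrite -[LHS]/(mxform (rdiag qi) w) mxform_rdiag.
have uu : \tr (u ^t* *m u) = gamma%:C.
  rewrite mxtrace_mulC /mxtrace big_ord1 mxE rmorph_sum; apply: eq_bigr => i _.
  by rewrite !mxE -sqnC ui sqnM sqn_real mulrC.
have AZ : A *m Z = 1%:M.
  have qq : rdiag q *m rdiag qi = 1%:M.
    by apply: rdiag_inv => i; rewrite gt_eqF.
  rewrite /A /Z mulmxBr !mulmxDl qq -!scalemxAr -!scalemxAl.
  rewrite !mulmxA.
  have -> : rdiag q *m u ^t* = w ^t* by rewrite uE mulmxA qq mul1mx.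
  have -> : w ^t* *m w *m u ^t* *m u = beta%:C *: (w ^t* *m u).
    by rewrite -[w ^t* *m w *m _]mulmxA wu mul_mx_scalar -scalemxAl.
  rewrite -[_ *m w *m rdiag _]mulmxA uw !scalerA -scalerDl -addrA -scalerBl.
  rewrite -!rmorphM -rmorphD -rmorphB.
  have -> : s - (c + c * s * beta) = 0 by rewrite /c; field; rewrite gt_eqF.
  by rewrite rmorph0 scale0r addr0.
apply: (@barrier_inv _ _ (P ^t* *m Z *m P)).
- rewrite !trmxC_mul trmxCK mulmxA /A trmxCD trmxCZ trmxC_rdiag.
  by rewrite trmxC_mul trmxCK.
- move=> y y0; rewrite mxform_conj /A mxformD mxformZ mxform_rdiag mxform_rank1.
  set y' := y *m _.
  have y'0 : y' != 0.
    apply: contraNneq y0 => y'0; rewrite -[y]mulmx1 -(unitarymxC uP) mulmxA.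
    by rewrite -/y' y'0 mul0mx.
  rewrite -rmorphM -rmorphD (@ltcR _ 0) ltr_pwDl //; last first.
    by rewrite mulr_ge0 ?sqn_ge0 // ltW.
  have /matrix0Pn[i0 [i y'i]] := y'0.
  rewrite (ord1 i0) in y'i.
  rewrite (bigD1 i) //= ltr_pwDl //.
    by rewrite mulr_gt0 // lt_def sqn_ge0 sqn_eq0 y'i.
  by apply: sumr_ge0 => j _; rewrite mulr_ge0 ?sqn_ge0 // ltW.
- rewrite -!mulmxA [P *m (_ *m _)]mulmxA (unitarymxP uP) mul1mx.
  rewrite [A *m _]mulmxA AZ mul1mx; exact: unitarymxC.
rewrite mxtrace_spectral // /Z linearB linearZ /= uu mxtrace_rdiag.
rewrite -rmorphM -rmorphB lecR; apply: le_trans sp.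
rewrite lerBlDr -lerBlDl -sumrB -/Delta /c.
rewrite mulrAC ler_pdivlMr //.
have -> : 1 + s * beta = s * (a + beta) by rewrite mulrDr /s mulVf // gt_eqF.
rewrite aE2 subrK.
by have -> : Delta * (s * (gamma / Delta)) = s * gamma by field; rewrite gt_eqF.
Qed.

Lemma barrier_ge0 n (X : 'M[C]_n) y : barrier X -> 0 <= mxform X y.
Proof.
case=> P [l [_ -> l0 _]]; rewrite mxform_conj mxform_rdiag ler0c.
by apply: sumr_ge0 => i _; rewrite mulr_ge0 ?sqn_ge0 // ltW.
Qed.

Lemma rdiag_barrier n (l : 'I_n -> R) : (forall i, 0 < l i) ->
  \sum_i (l i)^-1 <= 4^-1 -> barrier (rdiag l).
Proof.
move=> l0 sl; exists 1%:M, l; split => //.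
  by apply/unitarymxP; rewrite trmx1 map_mx1 mulmx1.
by rewrite /spectral_form trmx1 map_mx1 mulmx1 mul1mx.
Qed.

(* [P] and [l] range over the diagonalizations of the Hermitian forms. *)
Lemma lower_barrier_selection (T : Type) (D : set T) n (v : T -> 'rV[C]_n)
    (r : T -> R) (l0 : 'I_n -> R) (t0 : T) : D t0 ->
  (forall t, D t -> 0 <= r t) ->
  (forall (P : 'M[C]_n) (l : 'I_n -> R), P \is unitarymx ->
     2^-1 <= \sum_i l i ->
     exists2 t, D t & r t < \sum_i l i * sqn ((v t *m P ^t*) 0 i)) ->
  (forall i, 0 < l0 i) -> \sum_i (l0 i)^-1 <= 4^-1 ->
  forall m, exists (x : 'I_m -> T) (s : 'I_m -> R),
    [/\ forall k, D (x k), forall k, 0 <= s k /\ s k * r (x k) <= 1 &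
      forall y : 'rV[C]_n, m%:R * \sum_i sqn (y 0 i) <=
        \sum_i l0 i * sqn (y 0 i) +
        \sum_k s k * sqn ((y *m (v (x k)) ^t*) 0 0)].
Proof.
move=> Dt0 r0 avg l00 sl0 m.
case: n v l0 avg l00 sl0 => [|n] v l0 avg l00 sl0.
  (* Dimension 0 is separate because [barrier_step] needs a nonempty spectrum; both sides vanish for
     zero weights. *)
  exists (fun=> t0), (fun=> 0); split => // [k|y]; first by rewrite mul0r ler01.
  rewrite !big_ord0 mulr0 add0r.
  by apply: sumr_ge0 => k _; rewrite mul0r.
suff [x [s [Dx sx bX]]] : exists (x : 'I_m -> T) (s : 'I_m -> R),
    [/\ forall k, D (x k), forall k, 0 <= s k /\ s k * r (x k) <= 1 &
    barrier (rdiag l0 - (m%:R%:C) *: 1%:M +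
             \sum_k (s k)%:C *: ((v (x k)) ^t* *m v (x k)))].
  exists x, s; split => // y.
  have := barrier_ge0 y bX.
  rewrite mxformD -scaleNr mxformD -rmorphN mxformZ mxform1 mxform_rdiag.
  have -> : mxform (\sum_k (s k)%:C *: ((v (x k)) ^t* *m v (x k))) y =
      (\sum_k s k * sqn ((y *m (v (x k)) ^t*) 0 0))%:C.
    rewrite rmorph_sum; elim/big_rec2: _ => [|k a A _ <-].
      by rewrite /mxform mulmx0 mul0mx mxE.
    rewrite mxformD mxformZ mxform_rank1; congr (_ + _).
    exact/esym/rmorphM.
  by rewrite -rmorphM -!rmorphD ler0c mulNr; lra.
elim: m => [|m [x [s [Dx sx bX]]]].
  exists (fun=> t0), (fun=> 0); split => // [k|]; first by case: k.
  by rewrite scale0r big_ord0 subr0 addr0; exact: rdiag_barrier.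
have [P [l [uP sl step]]] := barrier_step bX.
have [t Dt rt] := avg P l uP sl.
set a := \sum_i _ in rt.
have a0 : 0 < a by apply: le_lt_trans rt; exact: r0.
(* The new point takes the index [ord_max] and the weight [1 / a]; [r t < a] bounds its cost by
   1. *)
exists (fun k => if unlift ord_max k is Some j then x j else t).
exists (fun k => if unlift ord_max k is Some j then s j else a^-1).
split => [k|k|]; try by case: unliftP.
  case: unliftP => [j _|_]; first exact: sx.
  by rewrite invr_ge0 ltW // mulrC ler_pdivrMr // mul1r ltW.
rewrite big_ord_recr /= unlift_none.
have wE k : widen_ord (leqnSn m) k = lift ord_max k.
  by apply: val_inj; rewrite /= /bump leqNgt ltn_ord.
under eq_bigr => k _ do rewrite wE liftK.
have := step (v t) a erefl a0.
congr (barrier _).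
rewrite addrA; congr (_ + _).
rewrite -natr1 rmorphD rmorph1 scalerDl scale1r opprD.
by rewrite addrA addrAC.
Qed.

End LowerBarrier.

(** * Hermitian forms and orthonormal systems *)

Section HermitianForm.
Variables (R : realType) (V : lmodType R[i]) (G : V -> V -> R[i]).
Local Notation C := R[i].
Local Notation "a %:C" := (real_complex R a).
Implicit Types (f g h : V) (a c : C).

(** Possibly indefinite: it is also applied to [m * ip - L2_form], whose nonnegativity is known only
    on a subspace. *)
Definition hermitian_form := (forall a f g h, G (a *: f + g) h = a * G f h + G g h)
  /\ forall f g, G g f = (G f g)^*.

Definition quad f : R := complex.Re (G f f).

Hypothesis hG : hermitian_form.

Lemma form0l h : G 0 h = 0.
Proof.
have /eqP := hG.1 1 0 0 h.
by rewrite scale1r addr0 mul1r eq_sym -subr_eq0 addrK => /eqP.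
Qed.

Lemma formC f g : G g f = (G f g)^*. Proof. exact: hG.2. Qed.

Lemma formDl f g h : G (f + g) h = G f h + G g h.
Proof. by rewrite -[f]scale1r hG.1 mul1r scale1r. Qed.

Lemma formZl a f h : G (a *: f) h = a * G f h.
Proof. by rewrite -[a *: f]addr0 hG.1 form0l addr0. Qed.

Lemma formNl f h : G (- f) h = - G f h.
Proof. by rewrite -scaleN1r formZl mulN1r. Qed.

Lemma formBl f g h : G (f - g) h = G f h - G g h.
Proof. by rewrite formDl formNl. Qed.

Lemma form_suml (I : Type) (r : seq I) (F : I -> V) h :
  G (\sum_(i <- r) F i) h = \sum_(i <- r) G (F i) h.
Proof.
elim: r => [|i r IH]; first by rewrite !big_nil form0l.
by rewrite !big_cons formDl IH.
Qed.

Lemma formDr f g h : G h (f + g) = G h f + G h g.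
Proof. by rewrite formC formDl rmorphD /= -!formC. Qed.

Lemma formZr a f h : G h (a *: f) = a^* * G h f.
Proof. by rewrite formC formZl rmorphM /= -formC. Qed.

Lemma formNr f h : G h (- f) = - G h f.
Proof. by rewrite formC formNl rmorphN /= -formC. Qed.

Lemma formBr f g h : G h (f - g) = G h f - G h g.
Proof. by rewrite formDr formNr. Qed.

Lemma form0r h : G h 0 = 0.
Proof. by rewrite formC form0l rmorph0. Qed.

Lemma form_sumr (I : Type) (r : seq I) (F : I -> V) h :
  G h (\sum_(i <- r) F i) = \sum_(i <- r) G h (F i).
Proof.
rewrite formC form_suml rmorph_sum; apply: eq_bigr => i _.
exact/esym/formC.
Qed.

Lemma quadE f : G f f = (quad f)%:C.
Proof. by rewrite /quad RRe_real //; apply/CrealP; rewrite -formC. Qed.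

Lemma quad0 : quad 0 = 0.
Proof. by rewrite /quad form0l. Qed.

Lemma quadD f g : quad (f + g) = quad f + quad g + 2 * complex.Re (G f g).
Proof.
rewrite /quad !formDl !formDr [G g f]formC.
by case: (G f f) (G g g) (G f g) => [a b] [c d] [u v] /=; ring.
Qed.

Lemma quadZ a f : quad (a *: f) = sqn a * quad f.
Proof.
apply: (@complexI R); rewrite -quadE formZl formZr quadE rmorphM /= sqnC.
by rewrite mulrA.
Qed.

Lemma quadN f : quad (- f) = quad f.
Proof. by rewrite /quad formNl formNr opprK. Qed.

Lemma quadB f g : quad (f - g) = quad f + quad g - 2 * complex.Re (G f g).
Proof. by rewrite quadD quadN formNr; case: (G f g) => a b /=; ring. Qed.

Lemma quad_parallelogram f g : quad (f + g) = 2 * quad f + 2 * quad g - quad (f - g).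
Proof. by rewrite quadD quadB; ring. Qed.

Lemma quadD_le f g : 0 <= quad (f - g) -> quad (f + g) <= 2 * quad f + 2 * quad g.
Proof. by rewrite (quad_parallelogram f g); lra. Qed.

(** Along [c = - t b] the term linear in [t] is negative unless [b = 0], and it dominates for small
    [t > 0]. Positivity is asked only on the line [f + c *: h], which suits forms that are
    nonnegative on a subspace. *)
Lemma quad_kernel f h : (forall c, 0 <= quad (f + c *: h)) -> quad f = 0 ->
  G f h = 0.
Proof.
move=> pos f0; set b := G f h.
pose q := quad h.
have key (t : R) : 0 <= t ^+ 2 * (sqn b * q) - 2 * t * sqn b.
  have E : G f (((- t)%:C * b) *: h) = (- t * sqn b)%:C.
    rewrite formZr [X in X * _]rmorphM /= conj_realC -/b.
    by rewrite -mulrA [_ * b]mulrC -sqnC -rmorphM.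
  have := pos ((- t)%:C * b).
  by rewrite quadD quadZ sqnM sqn_real f0 E sqrrN -/q /=; lra.
have qb : 0 <= sqn b * q by have := key 1; have := key (-1); lra.
have b0 := sqn_ge0 b.
apply/eqP; rewrite -sqn_eq0 eq_le b0 andbT.
(* The value [t = 1] serves for [q <= 1], and [t = 1 / q] otherwise. *)
have [q1|q1] := leP q 1.
  have : 0 <= sqn b * (1 - q) by rewrite mulr_ge0 // subr_ge0.
  have := key 1; rewrite expr1n !mul1r mulr1 => h1 h2.
  by rewrite mulrBr mulr1 in h2; lra.
have q0 : 0 < q^-1 by rewrite invr_gt0; lra.
have := key q^-1.
have -> : q^-1 ^+ 2 * (sqn b * q) - 2 * q^-1 * sqn b = - (q^-1 * sqn b).
  by field; lra.
by rewrite oppr_ge0 pmulr_rle0.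
Qed.

Lemma form_CauchySchwarz f g : (forall f, 0 <= quad f) ->
  sqn (G f g) <= quad f * quad g.
Proof.
move=> pos.
have [g0|gN0] := eqVneq (quad g) 0.
  rewrite g0 mulr0 formC quad_kernel ?rmorph0 //; first by rewrite sqn0.
have gp : 0 < quad g by rewrite lt_def gN0 pos.
have := pos ((quad g)%:C *: f - G f g *: g).
rewrite quadB !quadZ sqn_real formZl formZr.
rewrite [_^* * G f g]mulrC -sqnC -rmorphM /=.
set b := quad g; set a := quad f; set c := sqn _ => h.
rewrite -(ler_pM2l gp) -/b; move: h; nra.
Qed.

End HermitianForm.

Section OrthoSystem.
Variables (R : realType) (V : lmodType R[i]) (ip : V -> V -> R[i]).
Local Notation C := R[i].
Local Notation "a %:C" := (real_complex R a).
Local Notation n2 := (quad ip).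
Hypotheses (hip : hermitian_form ip) (ip_ge0 : forall f, 0 <= n2 f).
Implicit Types (f g h : V) (e : nat -> V).

(* Vanishing members are allowed, so that a finite orthonormal system is also
   an infinite one. *)
Definition ortho_system e := (forall i j, i != j -> ip (e i) (e j) = 0) /\
  forall i, e i = 0 \/ n2 (e i) = 1.

Definition proj e N f := \sum_(i < N) ip f (e i) *: e i.
Definition res e N f := f - proj e N f.

Lemma proj_res e N f : f = proj e N f + res e N f.
Proof. by rewrite addrCA subrr addr0. Qed.

Variable e : nat -> V.
Hypothesis oe : ortho_system e.

Lemma ortho_ipM f i : ip f (e i) * ip (e i) (e i) = ip f (e i).
Proof.
case: (oe.2 i) => [->|e1]; first by rewrite form0r // mul0r.
by rewrite [X in _ * X]quadE // e1 rmorph1 mulr1.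
Qed.

Lemma ip_proj N f i : (i < N)%N -> ip (proj e N f) (e i) = ip f (e i).
Proof.
move=> iN; rewrite form_suml // (bigD1 (Ordinal iN)) //= big1 => [|j ji].
  by rewrite formZl // ortho_ipM addr0.
by rewrite formZl // oe.1 ?mulr0.
Qed.

Lemma ip_res N f i : (i < N)%N -> ip (res e N f) (e i) = 0.
Proof. by move=> iN; rewrite formBl // ip_proj // subrr. Qed.

Lemma ip_proj_orth N f h : (forall i, (i < N)%N -> ip h (e i) = 0) ->
  ip (proj e N f) h = 0.
Proof.
move=> hN; rewrite form_suml // big1 // => i _.
by rewrite formZl // (formC hip h) hN // rmorph0 mulr0.
Qed.

Lemma n2_proj N f : n2 (proj e N f) = \sum_(i < N) sqn (ip f (e i)).
Proof.
apply: (@complexI R); rewrite -quadE // rmorph_sum [in X in ip _ X]/proj.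
rewrite form_sumr //; apply: eq_bigr => i _.
by rewrite formZr // ip_proj // mulrC -sqnC.
Qed.

Lemma n2_split N f : n2 f = \sum_(i < N) sqn (ip f (e i)) + n2 (res e N f).
Proof.
rewrite {1}(proj_res e N f) quadD // ip_proj_orth ?mulr0 ?addr0 ?n2_proj //.
by move=> i iN; rewrite ip_res.
Qed.

Lemma bessel N f : \sum_(i < N) sqn (ip f (e i)) <= n2 f.
Proof. by rewrite [leRHS](n2_split N) lerDl. Qed.

Lemma bessel1 i f : sqn (ip f (e i)) <= n2 f.
Proof.
apply: le_trans (bessel i.+1 f); rewrite big_ord_recr /= lerDr.
by apply: sumr_ge0 => j _; exact: sqn_ge0.
Qed.

Lemma n2_res_le N f : n2 (res e N f) <= n2 f.
Proof. by rewrite [leRHS](n2_split N) lerDr sumr_ge0 // => i _; exact: sqn_ge0. Qed.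

Lemma ip_res_self N f : ip (res e N f) f = (n2 (res e N f))%:C.
Proof.
rewrite [X in ip _ X](proj_res e N) formDr // -quadE // (formC hip (proj e N f)).
by rewrite ip_proj_orth ?rmorph0 ?add0r // => i iN; rewrite ip_res.
Qed.

End OrthoSystem.

(** * Greedy sequences and Gram-Schmidt orthonormalization *)

Section Greedy.

(** Dependent choice in which the next term depends on the whole prefix; a continuation is demanded
    only for prefixes that were built correctly. *)
Lemma greedy_sequence (V : choiceType) (x0 : V) (Q : seq V -> V -> Prop) :
  (forall e N, (forall i, (i < N)%N -> Q (mkseq e i) (e i)) ->
     exists h, Q (mkseq e N) h) ->
  exists e, forall N, Q (mkseq e N) (e N).
Proof.
move=> step.
pose next s := xget x0 [set h | Q s h].
pose es := fix es n := if n is m.+1 then rcons (es m) (next (es m)) else [::].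
pose e n := next (es n).
have esE n : es n = mkseq e n.
  by elim: n => // n IH; rewrite mkseqS -IH.
exists e => N; elim/ltn_ind: N => N IH.
have [h Qh] := step e N IH.
by rewrite /e esE /next; case: xgetP => [x -> //|/(_ h)].
Qed.

End Greedy.

Section GramSchmidt.
Variables (R : realType) (V : lmodType R[i]) (ip : V -> V -> R[i]).
Local Notation C := R[i].
Local Notation "a %:C" := (real_complex R a).
Local Notation n2 := (quad ip).
Hypotheses (hip : hermitian_form ip) (ip_ge0 : forall f, 0 <= n2 f).
Implicit Types (f g h : V) (e : nat -> V).

Definition orthogonal_to (s : seq V) h := forall x, x \in s -> ip h x = 0.

Lemma orthogonal_mkseq e N h :
  orthogonal_to (mkseq e N) h <-> forall i, (i < N)%N -> ip h (e i) = 0.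
Proof.
split => [oh i iN|oh x xs].
  by apply: oh; apply: map_f; rewrite mem_iota.
by case/mapP: xs => i; rewrite mem_iota => /= iN ->; exact: oh.
Qed.

(** Padding by zeros turns an orthonormal prefix into an infinite [ortho_system], so results about
    sequences apply during the construction. *)
Definition truncate e N i := if (i < N)%N then e i else 0.

Lemma mkseq_truncate e N : mkseq (truncate e N) N = mkseq e N.
Proof.
by apply/eq_in_map => i; rewrite mem_iota /truncate => /= ->.
Qed.

Lemma ortho_systemP e :
  (forall i, orthogonal_to (mkseq e i) (e i) /\ (e i = 0 \/ n2 (e i) = 1)) ->
  ortho_system ip e.
Proof.
move=> oe; split => [|i]; last by case: (oe i).
have lt i j : (i < j)%N -> ip (e j) (e i) = 0.
  by move=> ij; apply: (orthogonal_mkseq e j (e j)).1 => //; case: (oe j).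
move=> i j; case: ltngtP => // ij _; last exact: lt.
by rewrite (formC hip (e j)) lt // rmorph0.
Qed.

Lemma ortho_truncate e N :
  (forall i, (i < N)%N ->
     orthogonal_to (mkseq e i) (e i) /\ (e i = 0 \/ n2 (e i) = 1)) ->
  ortho_system ip (truncate e N).
Proof.
move=> oe; apply: ortho_systemP => i; rewrite {2 3 4}/truncate.
case: ltnP => [iN|_]; last first.
  by split; [move=> x _; rewrite form0l | left].
have [oi ei] := oe i iN; split => //.
apply/orthogonal_mkseq => j ji; rewrite /truncate (ltn_trans ji iN).
exact: (orthogonal_mkseq e i (e i)).1.
Qed.

Hypothesis ip_def : forall f, n2 f = 0 -> f = 0.

Lemma normalize v : exists h c, (h = 0 \/ n2 h = 1) /\ v = c *: h /\ exists c', h = c' *: v.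
Proof.
have [->|v0] := eqVneq v 0.
  by exists 0, 0; rewrite scale0r; split; [left|split => //; exists 0; rewrite scale0r].
have nv : 0 < n2 v.
  by rewrite lt_def ip_ge0 andbT; apply: contraNneq v0 => /ip_def ->.
have sv : Num.sqrt (n2 v) != 0 by rewrite gt_eqF // sqrtr_gt0.
exists ((Num.sqrt (n2 v))^-1%:C *: v), (Num.sqrt (n2 v))%:C; split; last split.
- right; rewrite quadZ // sqn_real exprVn sqr_sqrtr ?ip_ge0 //.
  by rewrite mulVf // gt_eqF.
- by rewrite scalerA -rmorphM /= divff // scale1r.
- by exists (Num.sqrt (n2 v))^-1%:C.
Qed.

(** The vector [d n] lies in the span of [b 0, ..., b n], recorded in [Q] as: whatever is orthogonal
    to these is orthogonal to [d n]. Hence the residual [g] of [f] satisfies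
    [ip g (f - d n) = n2 g], and Cauchy-Schwarz gives the bound. *)
Lemma gram_schmidt (d : nat -> V) : exists b, ortho_system ip b /\
  forall n N f, (n < N)%N -> n2 (res ip b N f) <= n2 (f - d n).
Proof.
pose Q s h := [/\ orthogonal_to s h, h = 0 \/ n2 h = 1 &
  forall g, orthogonal_to s g -> ip g h = 0 -> ip g (d (size s)) = 0].
have [b Qb] : exists b, forall N, Q (mkseq b N) (b N).
  apply: greedy_sequence => [|e N Qe]; first exact: 0.
  have oe : ortho_system ip (truncate e N).
    by apply: ortho_truncate => i iN; case: (Qe i iN).
  pose v := res ip (truncate e N) N (d N).
  have [h [c [h1 [vE [c' hE]]]]] := normalize v.
  exists h; rewrite -(mkseq_truncate e N); split => //.
    apply/orthogonal_mkseq => i iN.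
    by rewrite hE formZl // ip_res // mulr0.
  move=> g /orthogonal_mkseq og gh; rewrite size_mkseq.
  rewrite (proj_res ip (truncate e N) N (d N)) -/v formDr //.
  rewrite vE formZr // gh mulr0 addr0 formC //.
  by rewrite ip_proj_orth // rmorph0.
have ob : ortho_system ip b.
  by apply: ortho_systemP => i; case: (Qb i).
exists b; split => // n N f nN.
set g := res ip b N f.
have og i : (i < N)%N -> ip g (b i) = 0 by move=> iN; rewrite ip_res.
have gd : ip g (d n) = 0.
  have [_ _] := Qb n; move/(_ g); rewrite size_mkseq; apply; last exact: og.
  by apply/orthogonal_mkseq => i /ltn_trans/(_ nN); exact: og.
have : sqn (ip g (f - d n)) <= n2 g * n2 (f - d n).
  exact: form_CauchySchwarz.
rewrite formBr // gd subr0 ip_res_self // -/g sqn_real => h.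
have [->|g0] := eqVneq (n2 g) 0; first exact: ip_ge0.
have gp : 0 < n2 g by rewrite lt_def g0 ip_ge0.
by rewrite -(ler_pM2l gp) -expr2.
Qed.

End GramSchmidt.

Section DenseBasis.
Variables (R : realType) (H : completeNormedModType R[i]).
Variable ip : H -> H -> R[i].
Local Notation n2 := (quad ip).
Hypotheses (hip : hermitian_form ip) (normE : forall f : H, `|f| ^+ 2 = ip f f).

Lemma n2_ge0 f : 0 <= n2 f.
Proof. by rewrite -(ler0c (n2 f)) -quadE // -normE exprn_ge0. Qed.

Lemma n2_eq0 f : n2 f = 0 -> f = 0.
Proof.
move=> f0; have := normE f; rewrite quadE // f0 => /eqP.
by rewrite expf_eq0 /= normr_eq0 => /eqP.
Qed.

Lemma norm_n2 f : `|f| = real_complex R (Num.sqrt (n2 f)).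
Proof.
apply/eqP; rewrite -(@eqrXn2 _ 2) //; last by rewrite ler0c sqrtr_ge0.
by rewrite normE quadE // -rmorphXn /= sqr_sqrtr // n2_ge0.
Qed.

Lemma lt_norm_n2 f (r : R) : 0 <= r -> (`|f| < real_complex R r) = (n2 f < r ^+ 2).
Proof.
move=> r0; rewrite norm_n2 ltcR.
by rewrite -(ltr_pXn2r (n := 2)) ?nnegrE ?sqrtr_ge0 // sqr_sqrtr // n2_ge0.
Qed.

Lemma separable_basis : separable H -> exists b, ortho_system ip b /\
  forall f (eps : R), 0 < eps -> exists J, forall N, (J <= N)%N ->
    n2 (res ip b N f) <= eps.
Proof.
case=> S /countable_injP[p pinj] dS.
(* An enumeration of the dense set, inverting the injection [p]; indices outside its image get the
   value 0. *)
pose d n := xget 0 [set s | S s /\ p s = n].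
have [b [ob bd]] := gram_schmidt hip n2_ge0 n2_eq0 d.
exists b; split => // f eps eps0.
have se0 : 0 < Num.sqrt eps by rewrite sqrtr_gt0.
have [||s [/= fs Ss]] := dS (ball f (real_complex R (Num.sqrt eps))).
- by exists f; apply: ballxx; rewrite ltcR.
- exact: ball_open.
exists (p s).+1 => N sN; apply: (le_trans (bd _ _ f sN)).
have -> : d (p s) = s.
  rewrite /d; case: xgetP => [x _ [Sx px]|/(_ s)]; last by case; split.
  by apply: pinj => //; rewrite inE.
move: fs; rewrite -ball_normE /= lt_norm_n2; last exact: ltW.
by rewrite sqr_sqrtr ?(ltW eps0) // => /ltW.
Qed.

End DenseBasis.

(** * The embedding into L_2 and its eigenvectors *)

Section RealIntegrable.
Context {d : measure_display} {T : measurableType d} {R : realType}.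
Variables (mu : {measure set T -> \bar R}) (D : set T).
Hypothesis mD : measurable D.
Implicit Types f g : T -> R.

Definition intg f := mu.-integrable D (EFin \o f).

Lemma le_intg f g : measurable_fun D f ->
  (forall x, D x -> 0 <= f x <= g x) -> intg g -> intg f.
Proof.
move=> mf fg; apply: le_integrable => //; first exact/measurable_EFinP.
move=> x Dx; have /andP[f0 fx] := fg x Dx; rewrite /= lee_fin.
by rewrite !ger0_norm // (le_trans f0).
Qed.

Lemma eq_intg f g : (forall x, D x -> f x = g x) -> intg f -> intg g.
Proof.
move=> fg; apply: eq_integrable => // x.
by rewrite inE /= => Dx; rewrite fg.
Qed.

Lemma intgZl a f : intg f -> intg (fun x => a * f x).
Proof. by move=> /(integrableZl mD a). Qed.

Lemma intg_sum n (f : 'I_n -> T -> R) : (forall i, intg (f i)) ->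
  intg (fun x => \sum_i f i x).
Proof.
move=> fi; rewrite /intg.
have -> : EFin \o (fun x => \sum_i f i x) = (fun x => \sum_i (f i x)%:E)%E.
  by apply/funext => x; rewrite /= sumEFin.
by apply: (integrable_sum mD) => i _; exact: fi.
Qed.

Lemma intgB f g : intg f -> intg g -> intg (fun x => f x - g x).
Proof. by move=> fi gi; apply: eq_integrable (integrableB mD fi gi). Qed.

Lemma Rintegral_sum n (f : 'I_n -> T -> R) : (forall i, intg (f i)) ->
  \int[mu]_(x in D) (\sum_i f i x) = \sum_i \int[mu]_(x in D) f i x.
Proof.
elim: n f => [|n IH] f fi.
  by rewrite big_ord0; under eq_Rintegral do rewrite big_ord0; rewrite Rintegral_cst // mul0r.
rewrite big_ord_recl -IH; last by move=> i; exact: fi.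
rewrite -RintegralD //; [|exact: fi|by apply: intg_sum => i; exact: fi].
by apply: eq_Rintegral => x _; rewrite big_ord_recl.
Qed.

End RealIntegrable.

(** * Compactness along an ultrafilter, and dimension counting *)

Section UltraFilterOscillation.
Variables (R : realType) (T : Type) (G : set_system T).
Hypothesis UG : UltraFilter G.

(** By compactness of [[-1, 1]] the image of the ultrafilter clusters at some [p]. The preimage of a
    ball around [p] or its complement belongs to the ultrafilter, and the complement would
    contradict clustering. *)
Lemma ultra_oscillation (phi : T -> R) : G [set f | `|phi f| <= 1] ->
  forall eps, 0 < eps ->
  exists2 A, G A & forall f g, A f -> A g -> `|phi f - phi g| <= eps.
Proof.
move=> Gphi eps eps0.
have PF : ProperFilter (phi @ G) by exact: fmap_proper_filter.
have [|p [_ clp]] := @segment_compact R (-1) 1 (phi @ G).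
  apply: (@filterS _ G _ [set f | `|phi f| <= 1]) => // f /=.
  by rewrite in_itv /= ler_norml.
pose A := phi @^-1` ball p (eps / 2).
have e20 : 0 < eps / 2 by rewrite divr_gt0.
exists A; last first.
  move=> f g; rewrite /A /ball /= => fp gp.
  have -> : phi f - phi g = (p - phi g) - (p - phi f) by ring.
  by rewrite (le_trans (ler_normB _ _)) // [leRHS]splitr lerD // ltW.
have [//|GnA] := in_ultra_setVsetC A UG.
exfalso.
have [y [/= nAy By]] : ~` ball p (eps / 2) `&` ball p (eps / 2) !=set0.
  by apply: clp; [exact: GnA | exact: nbhsx_ballx].
by [].
Qed.

End UltraFilterOscillation.


(** If [m > n], the coefficient matrix has a nonzero left kernel vector, which is a linear relation
    among the [w i]. *)
Lemma lin_indep_le (F : fieldType) (V : lmodType F) m n (w : 'I_m -> V)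
    (v : 'I_n -> V) : lin_indep w ->
  (forall i, exists c : 'I_n -> F, w i = \sum_j c j *: v j) -> (m <= n)%N.
Proof.
move=> iw /choice[M wM]; pose A := \matrix_(i, j) M i j.
rewrite leqNgt; apply/negP => nm.
have kN0 : kermx A != 0.
  rewrite kermx_eq0 /row_free; apply: contraTneq (rank_leq_col A) => ->.
  by rewrite -ltnNge.
have /matrix0Pn[i0 [i1 ki]] := kN0.
have kA : kermx A *m A = 0 by rewrite mulmx_ker.
have := iw (fun i => kermx A i0 i) _ i1 => h; move: ki; rewrite h ?eqxx //.
under eq_bigr => i _ do rewrite wM scaler_sumr.
rewrite exchange_big big1 //= => j _.
under eq_bigr => i _ do rewrite scalerA.
rewrite -scaler_suml.
have /matrixP/(_ i0 j) := kA; rewrite !mxE => kj.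
suff -> : \sum_i kermx A i0 i * M i j = 0 by rewrite scale0r.
by rewrite -[RHS]kj; apply: eq_bigr => i _; rewrite !mxE.
Qed.


Lemma sum_uniq_eq (T : eqType) (s : seq T) (y : T) : uniq s ->
  (\sum_(x <- s) (y == x) = (y \in s))%N.
Proof.
move=> us; rewrite -count_uniq_mem // -sum1_count [RHS]big_mkcond.
by apply: eq_bigr => x _; rewrite /= eq_sym; case: eqP.
Qed.

(** * Pointwise bounds and the trace of the kernel *)

Section Embedding.
Context {d : measure_display} {T : measurableType d} {R : realType}.
Variables (mu : {measure set T -> \bar R}) (D : set T) (K : T -> T -> R[i]).
Variables (H : completeNormedModType R[i]) (HK : rkhs D K H).
Hypothesis mD : measurable D.
Hypothesis sepH : separable H.
Hypothesis measH : forall f : H, cmeasurable D (rkhs_eval HK f).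
Hypothesis traceK : (\int[mu]_(x in D) (complex.Re (K x x))%:E < +oo)%E.
Local Notation C := R[i].
Local Notation "a %:C" := (real_complex R a).
Local Notation ev := (rkhs_eval HK).
Local Notation k := (rkhs_section HK).
Implicit Types (f g h : H) (e : nat -> H).

Definition ip f g : C := rkhs_inner HK f g.
Local Notation n2 := (quad ip).

Lemma ip_hermitian : hermitian_form ip.
Proof.
split=> [a f g h|f g]; first by rewrite /ip linearPl.
by rewrite /ip hermC expr0 mul1r.
Qed.

Lemma ip_normE f : `|f| ^+ 2 = ip f f.
Proof. exact: rkhs_normE. Qed.

Let hip := ip_hermitian.
Lemma ip_ge0 f : 0 <= n2 f. Proof. exact: (n2_ge0 hip ip_normE). Qed.

Let ip0 := ip_ge0.

Lemma evE f x : D x -> ev f x = ip f (k x).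
Proof. exact: rkhs_reproducing. Qed.

Definition diag x := n2 (k x).

Lemma diagE x : D x -> complex.Re (K x x) = diag x.
Proof.
by move=> Dx; rewrite /diag /quad -evE // rkhs_sectionE.
Qed.

Lemma sqn_ev f x : D x -> sqn (ev f x) <= n2 f * diag x.
Proof. by move=> Dx; rewrite evE //; apply: form_CauchySchwarz => //; exact: ip_ge0. Qed.

Lemma measurable_sqn_ev f : measurable_fun D (fun x => sqn (ev f x)).
Proof.
have [mR mI] := measH f.
under eq_fun do rewrite sqnE.
by apply: measurable_funD; apply: measurable_funX.
Qed.

(** The diagonal of the kernel left over after projecting out the first [N] members of [e]. *)
Definition rest e N x := n2 (res ip e N (k x)).

Lemma restE e N x : ortho_system ip e -> D x ->
  rest e N x = diag x - \sum_(i < N) sqn (ev (e i) x).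
Proof.
move=> oe Dx; rewrite /diag (n2_split hip oe N (k x)) -/(rest e N x).
rewrite [X in X - _]addrC -addrA -[LHS]addr0; congr (_ + _).
apply/esym/eqP; rewrite subr_eq0; apply/eqP; apply: eq_bigr => i _.
by rewrite evE // formC // sqn_conj.
Qed.

Lemma rest_ge0 e N x : 0 <= rest e N x.
Proof. exact: ip_ge0. Qed.

Lemma rest_le e N x : ortho_system ip e -> rest e N x <= diag x.
Proof. by move=> oe; exact: (n2_res_le hip). Qed.

(** A residual is orthogonal to the projected part of the section at [x], so Cauchy-Schwarz involves
    only the residual of the section. *)
Lemma sqn_ev_res e N f x : ortho_system ip e -> D x ->
  sqn (ev (res ip e N f) x) <= n2 (res ip e N f) * rest e N x.
Proof.
move=> oe Dx; rewrite evE //.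
have -> : ip (res ip e N f) (k x) = ip (res ip e N f) (res ip e N (k x)).
  rewrite [in LHS](proj_res ip e N (k x)) formDr //.
  rewrite (formC hip (proj ip e N (k x))).
  rewrite (ip_proj_orth hip); first by rewrite rmorph0 add0r.
  by move=> i iN; rewrite ip_res.
by apply: form_CauchySchwarz => //; exact: ip_ge0.
Qed.

Lemma basis_exists : exists b, ortho_system ip b /\
  forall f (eps : R), 0 < eps -> exists J, forall N, (J <= N)%N ->
    n2 (res ip b N f) <= eps.
Proof. exact: (separable_basis hip ip_normE). Qed.

(** By Parseval the diagonal is the pointwise limit of the sums of [sqn (ev (b i) x)] over a basis,
    which are measurable. *)
Lemma measurable_diag : measurable_fun D diag.
Proof.
have [b [ob bb]] := basis_exists.
apply: (@measurable_fun_cvg _ _ _ _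
    (fun N x => \sum_(i < N) sqn (ev (b i) x))).
  by move=> N; apply: measurable_sum => i; exact: measurable_sqn_ev.
move=> x Dx; apply/cvgrPdist_le => eps eps0.
have [J bJ] := bb (k x) eps eps0.
near=> N; rewrite -restE // ger0_norm ?rest_ge0 // /rest bJ //.
by near: N; exists J.
Unshelve. all: by end_near. Qed.

Lemma intg_diag : intg mu D diag.
Proof.
apply/integrableP; split; first exact/measurable_EFinP/measurable_diag.
apply: le_lt_trans traceK; rewrite le_eqVlt; apply/orP; left; apply/eqP.
apply: eq_integral => x; rewrite inE => Dx.
by rewrite diagE //= ger0_norm // ip_ge0.
Qed.

Lemma intg_sqn_ev f : intg mu D (fun x => sqn (ev f x)).
Proof.
apply: (@le_intg _ _ _ _ _ _ _ (fun x => n2 f * diag x)) => //.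
- exact: measurable_sqn_ev.
- by move=> x Dx; rewrite sqn_ge0 sqn_ev.
- exact/intgZl/intg_diag.
Qed.

Lemma intg_rest e N : ortho_system ip e -> intg mu D (rest e N).
Proof.
move=> oe.
apply: (@eq_intg _ _ _ _ _ mD (fun x => diag x - \sum_(i < N) sqn (ev (e i) x))).
  by move=> x Dx; rewrite restE.
apply: intgB => //; first exact: intg_diag.
by apply: intg_sum => // i; exact: intg_sqn_ev.
Qed.

Definition q f : R := \int[mu]_(x in D) sqn (ev f x).
Definition trace : R := \int[mu]_(x in D) diag x.

Lemma q_ge0 f : 0 <= q f.
Proof. by apply: Rintegral_ge0 => x _; exact: sqn_ge0. Qed.

Lemma q_le_trace f : q f <= n2 f * trace.
Proof.
rewrite -RintegralZl //; last exact: intg_diag.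
apply: le_Rintegral => //; first exact: intg_sqn_ev.
  exact/intgZl/intg_diag.
by move=> x Dx; rewrite sqn_ev.
Qed.

Lemma trace_ge0 : 0 <= trace.
Proof. by apply: Rintegral_ge0 => x _; exact: ip_ge0. Qed.

Lemma integral_rest e N : ortho_system ip e ->
  \int[mu]_(x in D) rest e N x = trace - \sum_(i < N) q (e i).
Proof.
move=> oe; rewrite /q -Rintegral_sum //; last by move=> i; exact: intg_sqn_ev.
rewrite -RintegralB //; last first.
- by apply: intg_sum => // i; exact: intg_sqn_ev.
- exact: intg_diag.
by apply: eq_Rintegral => x; rewrite inE => Dx; rewrite restE.
Qed.

Lemma q_res_le e N f : ortho_system ip e ->
  q (res ip e N f) <= n2 (res ip e N f) * (trace - \sum_(i < N) q (e i)).
Proof.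
move=> oe; rewrite -integral_rest // -RintegralZl //; last exact: intg_rest.
apply: le_Rintegral => //; first exact: intg_sqn_ev.
  exact/intgZl/intg_rest.
by move=> x Dx; exact: sqn_ev_res.
Qed.

Lemma sum_q_le_trace e N : ortho_system ip e -> \sum_(i < N) q (e i) <= trace.
Proof.
move=> oe; rewrite -subr_ge0 -integral_rest //.
by apply: Rintegral_ge0 => x _; exact: rest_ge0.
Qed.

(** The remainders [rest b n] tend to 0 pointwise and are dominated by the integrable [diag], so
    their integrals tend to 0. *)
Lemma trace_basis b :
  ortho_system ip b ->
  (forall f (eps : R), 0 < eps -> exists J, forall N, (J <= N)%N ->
    n2 (res ip b N f) <= eps) ->
  forall eps : R, 0 < eps -> exists J, trace - \sum_(i < J) q (b i) <= eps.
Proof.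
move=> ob bb eps eps0.
have : (\int[mu]_(x in D) (rest b n x)%:E)%E @[n --> \oo] -->
       (\int[mu]_(x in D) (0 : R)%:E)%E.
  apply: (@dominated_cvg _ _ _ _ _ _ _ _ (EFin \o diag)) => //.
  - move=> n; apply/measurable_EFinP.
    apply: (eq_measurable_fun (fun x => diag x - \sum_(i < n) sqn (ev (b i) x))).
      by move=> x; rewrite inE => Dx; rewrite restE.
    apply: measurable_funB; first exact: measurable_diag.
    by apply: measurable_sum => i; exact: measurable_sqn_ev.
  - move=> x Dx; apply: cvg_EFin; first by near=> n.
    apply/cvgrPdist_le => t t0; have [J bJ] := bb (k x) t t0.
    near=> N; rewrite sub0r normrN /= ger0_norm ?rest_ge0 // /rest bJ //.
    by near: N; exists J.
  - exact: intg_diag.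
  - by move=> n x Dx; rewrite /= lee_fin ger0_norm ?rest_ge0 // rest_le.
rewrite integral0 => /fine_cvgP[_ /cvgrPdist_le/(_ eps eps0)[J _ /(_ J)]] /=.
rewrite leqnn sub0r normrN => /(_ isT) h; exists J.
by rewrite -integral_rest // (le_trans _ h) // ler_norm.
Unshelve. all: by end_near. Qed.

(** * The L_2 form on [H] and its eigenvectors *)

Variable Idstar : (T -> R[i]) -> H.
Hypothesis adjI : is_adjoint_Id mu HK Idstar.

Lemma integral_sqn_ev f :
  (\int[mu]_(x in D) (Normc.normc (ev f x) ^+ 2)%:E)%E = (q f)%:E.
Proof.
rewrite /q /Rintegral fineK //; apply: integrable_fin_num => //.
exact: intg_sqn_ev.
Qed.

Lemma L2_ev f : L2 mu D (ev f).
Proof. by split; [exact: measH | rewrite /L2_norm integral_sqn_ev ltry]. Qed.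

Definition L2_form f g : C := L2_inner mu D (ev f) (ev g).

Lemma L2_form_adjoint f g : L2_form f g = ip (Idstar (ev f)) g.
Proof. by rewrite /ip adjI //; exact: L2_ev. Qed.

Lemma intg_Im f g : intg mu D (fun x => complex.Im (ev f x * (ev g x)^*)).
Proof.
have [mRf mIf] := measH f; have [mRg mIg] := measH g.
have E x : complex.Im (ev f x * (ev g x)^*) =
    complex.Im (ev f x) * complex.Re (ev g x) -
    complex.Re (ev f x) * complex.Im (ev g x).
  by case: (ev f x) (ev g x) => a b [u v] /=; ring.
have mI : measurable_fun D (fun x => complex.Im (ev f x * (ev g x)^*)).
  under eq_fun do rewrite E.
  by apply: measurable_funB; apply: measurable_funM.
apply: (@le_integrable _ _ _ _ _ mD _ (EFin \o (fun x => sqn (ev f x) + sqn (ev g x)))).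
- exact/measurable_EFinP.
- move=> x Dx; rewrite /= lee_fin E !sqnE.
  move: (ev f x) (ev g x) => [a b] [u v] /=.
  rewrite [leRHS]ger0_norm ?addr_ge0 ?sqr_ge0 // ler_norml.
  have := sqr_ge0 (a - v); have := sqr_ge0 (a + v).
  have := sqr_ge0 (b - u); have := sqr_ge0 (b + u).
  by rewrite !sqrrD ?sqrrN; lra.
- apply: eq_integrable (integrableD mD (intg_sqn_ev f)
    (intg_sqn_ev g)) => //.
Qed.

(** Only the symmetry is proved under the integral; linearity is carried over from [ip] through the
    adjoint. *)
Lemma L2_form_hermitian : hermitian_form L2_form.
Proof.
have hC f g : L2_form g f = (L2_form f g)^*.
  have E x : ev g x * (ev f x)^* = (ev f x * (ev g x)^*)^*.
    by rewrite rmorphM /= conjCK mulrC.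
  rewrite /L2_form /L2_inner.
  apply/eqP; rewrite eq_complex /=; apply/andP; split; apply/eqP.
    by apply: eq_Rintegral => x _; rewrite E; case: (_ * _).
  rewrite -mulN1r -RintegralZl //; last exact: intg_Im.
  by apply: eq_Rintegral => x _; rewrite E mulN1r; case: (_ * _).
split=> // a f g h.
rewrite (hC h (_ + _)) (hC h f) (hC h g) !L2_form_adjoint.
by rewrite formDr // formZr // rmorphD rmorphM /= conjCK.
Qed.

Lemma quad_L2_form f : quad L2_form f = q f.
Proof.
rewrite /quad /L2_form /L2_inner /=; apply: eq_Rintegral => x _.
by rewrite -sqnC.
Qed.

Let hB := L2_form_hermitian.

Lemma qD_le f g : q (f + g) <= 2 * q f + 2 * q g.
Proof.
rewrite -!quad_L2_form; apply: quadD_le => //.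
by rewrite quad_L2_form; exact: q_ge0.
Qed.

(* Along an ultrafilter refining the maximizing sets, all coordinates in a basis
   converge, hence [q (f - g)] tends to 0 because the trace is finite.  By the
   parallelogram identity, [q (f + g)] close to [4 m] then forces [f - g] to be
   small in norm. *)
Lemma maximizing_limit (U : set H) (m : R) :
  (forall f g, U f -> U g -> U (f + g)) -> 0 < m ->
  (forall f, U f -> q f <= m * n2 f) ->
  (forall t, 0 < t -> exists f, [/\ U f, n2 f <= 1 & m - t < q f]) ->
  exists f0, forall t, 0 < t ->
    exists f, [/\ U f, n2 f <= 1, m - t < q f & n2 (f - f0) <= t].
Proof.
move=> UD m0 qm approx.
pose S t := [set f | [/\ U f, n2 f <= 1 & m - t < q f]].
pose F0 := filter_from [set t : R | 0 < t] S.
have PF0 : ProperFilter F0.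
  apply: filter_from_proper; last by move=> t /= /approx [f]; exists f.
  apply: filter_from_filter; first by exists 1 => /=.
  move=> s t /= s0 t0; exists (Num.min s t); first by rewrite lt_min s0.
  move=> f [Uf nf qf]; split; split => //.
    by apply: le_lt_trans qf; rewrite lerD2l lerN2 ge_min lexx.
  by apply: le_lt_trans qf; rewrite lerD2l lerN2 ge_min lexx orbT.
have [G [UG FG]] := ultraFilterLemma PF0.
have GS t : 0 < t -> G (S t) by move=> t0; apply: FG; exists t.
have [b [ob bb]] := basis_exists.
have coord j t : 0 < t -> exists2 A, G A &
    forall f g, A f -> A g -> sqn (ip (f - g) (b j)) <= t.
  move=> t0; pose s := Num.sqrt (t / 2).
  have s0 : 0 < s by rewrite sqrtr_gt0 divr_gt0.
  have ss : s ^+ 2 = t / 2 by rewrite sqr_sqrtr // divr_ge0 // ltW.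
  have bnd f : n2 f <= 1 -> sqn (ip f (b j)) <= 1.
    by apply: le_trans; exact: bessel1.
  have abs1 (a c : R) : a ^+ 2 + c ^+ 2 <= 1 -> `|a| <= 1.
    move=> h; rewrite -(@ler_pXn2r _ 2) ?nnegrE // expr1n real_normK ?num_real //.
    by have := sqr_ge0 c; lra.
  have [|A GA hA] := @ultra_oscillation R H G UG (fun f => complex.Re (ip f (b j))) _ s s0.
    apply: filterS (GS 1 ltr01) => f [_ /bnd nf _] /=.
    by move: nf; rewrite sqnE; exact: abs1.
  have [|B GB hB'] := @ultra_oscillation R H G UG (fun f => complex.Im (ip f (b j))) _ s s0.
    apply: filterS (GS 1 ltr01) => f [_ /bnd nf _] /=.
    by move: nf; rewrite sqnE addrC; exact: abs1.
  exists (A `&` B); first exact: filterI.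
  move=> f g [Af Bf] [Ag Bg]; have := hA f g Af Ag; have := hB' f g Bf Bg.
  rewrite formBl // sqnE.
  move: (ip f (b j)) (ip g (b j)) => [x y] [u v] /= h1 h2.
  have sq (z : R) : `|z| <= s -> z ^+ 2 <= t / 2.
    by move=> h; rewrite -ss -[leLHS]real_normK ?num_real // ler_pXn2r ?nnegrE // ltW.
  by rewrite [leRHS]splitr lerD // sq.
have coords J t : 0 < t -> exists2 A, G A &
    forall f g, A f -> A g -> \sum_(j < J) sqn (ip (f - g) (b j)) <= t.
  elim: J t => [|J IH] t t0.
    by exists setT; [exact: filterT | move=> f g _ _; rewrite big_ord0 ltW].
  have t20 : 0 < t / 2 by rewrite divr_gt0.
  have [A GA hA] := IH _ t20; have [B GB hB'] := coord J _ t20.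
  exists (A `&` B); first exact: filterI.
  move=> f g [Af Bf] [Ag Bg]; rewrite big_ord_recr /= [leRHS]splitr lerD //.
    exact: hA.
  exact: hB'.
have tr0 := trace_ge0.
have cauchyG t : 0 < t -> exists2 A, G A &
    forall f g, A f -> A g -> n2 (f - g) <= t.
  (* The losses to absorb are [4 s] from the near-maximality of [f] and [g], and [2 s trace + 8 s]
     from [q (f - g)]. *)
  move=> t0; pose s := m * t / (12 + 2 * trace).
  have c0 : 0 < 12 + 2 * trace by lra.
  have s0 : 0 < s by rewrite divr_gt0 // mulr_gt0.
  have [J hJ] := trace_basis ob bb s0.
  have [A GA hA] := coords J s s0.
  exists (A `&` S s); first by apply: filterI => //; exact: GS.
  move=> f g [Af [Uf nf qf]] [Ag [Ug ng qg]].
  have nh : n2 (f - g) <= 4.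
    have := quad_parallelogram hip f g; have := ip0 (f + g); lra.
  have qh : q (f - g) <= 2 * (s * trace) + 2 * (4 * s).
    rewrite (proj_res ip b J (f - g)); apply: (le_trans (qD_le _ _)).
    apply: lerD; rewrite ler_pM2l //.
      apply: (le_trans (q_le_trace _)).
      by rewrite n2_proj // ler_wpM2r //; exact: hA.
    apply: (le_trans (q_res_le _ _ ob)).
    apply: ler_pM; [exact: ip0 | | | exact: hJ].
      by rewrite subr_ge0; exact: (sum_q_le_trace _ ob).
    by apply: le_trans nh; exact: n2_res_le.
  have := qm _ (UD _ _ Uf Ug).
  have -> : q (f + g) = 2 * q f + 2 * q g - q (f - g).
    by rewrite -!quad_L2_form; exact: quad_parallelogram.
  rewrite (quad_parallelogram hip f g) => key.
  have ms : m * t = s * (12 + 2 * trace) by rewrite /s mulfVK // gt_eqF.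
  rewrite -(ler_pM2l m0) ms.
  have : m * n2 f <= m by rewrite ler_piMr // ltW.
  have : m * n2 g <= m by rewrite ler_piMr // ltW.
  by move: key; rewrite mulrBr !mulrDr; lra.
have cvgG : cvg G.
  apply/cauchy_cvgP/cauchy_ballP => eps eps0.
  have [re [re0 epsE]] : exists r : R, 0 < r /\ eps = r%:C.
    have /complex_realP[r er] : eps \is Num.real by rewrite realE (ltW eps0).
    by exists r; split => //; move: eps0; rewrite er ltcR.
  have [|A GA hA] := cauchyG (re ^+ 2 / 2); first by rewrite divr_gt0 ?exprn_gt0.
  exists (A, A) => // -[f g] [/= Af Ag].
  rewrite -ball_normE /= epsE (lt_norm_n2 hip ip_normE); last exact: ltW.
  apply: (le_lt_trans (hA _ _ Af Ag)).
  by rewrite ltr_pdivrMr // ltr_pMr ?exprn_gt0 // ltr1n.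
exists (lim G) => t t0.
have Gt : G [set f | n2 (f - lim G) <= t].
  have : G (ball (lim G) (Num.sqrt t)%:C).
    by apply: cvgG; apply: nbhsx_ballx; rewrite ltcR sqrtr_gt0.
  apply: filterS => f; rewrite -ball_normE /= distrC.
  rewrite (lt_norm_n2 hip ip_normE) ?sqrtr_ge0 //.
  by rewrite sqr_sqrtr ?(ltW t0) // => /ltW.
by have [f [[Uf nf qf] ft]] := filter_ex (filterI (GS t t0) Gt); exists f.
Qed.

(* Weak form of W h = q(h) h: the eigenvalue of a unit eigenvector is its
   squared norm in L_2. *)
Definition eigen h := forall g, L2_form h g = (q h)%:C * ip h g.

Lemma eigen0 : eigen 0.
Proof. by move=> g; rewrite /eigen !form0l // mulr0. Qed.

Lemma qZ (c : C) f : q (c *: f) = sqn c * q f.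
Proof. by rewrite -!quad_L2_form quadZ. Qed.

Lemma q0 : q 0 = 0.
Proof. by rewrite -quad_L2_form quad0. Qed.

(** The supremum [m] of [q] over the unit ball of the orthogonal complement [U] is attained at a
    limit [f0]. The form [m * ip - L2_form] is nonnegative on [U] and vanishes at [f0], so [f0] lies
    in its kernel, and normalizing [f0] gives [h]. *)
Lemma max_eigenvector e N : ortho_system ip e -> (forall i, eigen (e i)) ->
  exists h, [/\ forall i, (i < N)%N -> ip h (e i) = 0, h = 0 \/ n2 h = 1,
    eigen h & forall f, (forall i, (i < N)%N -> ip f (e i) = 0) ->
      q f <= q h * n2 f].
Proof.
move=> oe ee.
pose U := [set f | forall i, (i < N)%N -> ip f (e i) = 0].
have UD f g : U f -> U g -> U (f + g).
  by move=> Uf Ug i iN; rewrite formDl // Uf // Ug // addr0.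
have UZ c f : U f -> U (c *: f).
  by move=> Uf i iN; rewrite formZl // Uf // mulr0.
(* When [q] vanishes on [U], the zero vector serves. *)
have [[f1 [Uf1 qf1]]|nf] := pselect (exists f, U f /\ 0 < q f); last first.
  exists 0; split; [by move=> i _; rewrite form0l|by left|exact: eigen0|].
  move=> f Uf; rewrite q0 mul0r leNgt; apply/negP => qf.
  by apply: nf; exists f.
pose E := [set q f | f in [set f | U f /\ n2 f <= 1]].
pose m := sup E.
have supE : has_sup E.
  split.
    exists (q 0), 0 => //.
    by split; [move=> i _; rewrite form0l | rewrite quad0 // ler01].
  exists trace => _ [f [_ nf] <-].
  apply: (le_trans (q_le_trace f)).
  by rewrite ler_piMl // trace_ge0.
have qm f : U f -> q f <= m * n2 f.
  move=> Uf; have [f0|fN0] := eqVneq (n2 f) 0.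
    by rewrite (n2_eq0 hip ip_normE f0) q0 quad0 // mulr0.
  have nf : 0 < n2 f by rewrite lt_def fN0 ip0.
  have sf : (Num.sqrt (n2 f))^-1 ^+ 2 = (n2 f)^-1 by rewrite exprVn sqr_sqrtr // ltW.
  rewrite -ler_pdivrMr // mulrC -sf -sqn_real -qZ.
  apply: sup_upper_bound => //; eexists; last reflexivity.
  by split; [exact: UZ | rewrite quadZ // sqn_real sf mulVf].
have m0 : 0 < m.
  have := lt_le_trans qf1 (qm _ Uf1).
  by apply: contraTT; rewrite -!leNgt => m_le0; rewrite mulr_le0_ge0.
have approx t : 0 < t -> exists f, [/\ U f, n2 f <= 1 & m - t < q f].
  move=> t0; have [_ [f [Uf nf] <-] ft] := sup_adherent t0 supE.
  by exists f.
have [f0 lim0] := maximizing_limit  UD m0 qm approx.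
have Uf0 : U f0.
  move=> i iN; apply/eqP; rewrite -sqn_eq0 eq_le sqn_ge0 andbT.
  apply/ler_addgt0Pr => t t0; rewrite add0r.
  have [f [Uf _ _ nt]] := lim0 t t0.
  have -> : sqn (ip f0 (e i)) = sqn (ip (f - f0) (e i)).
    by rewrite formBl // Uf // sub0r sqnN.
  by apply: le_trans nt; exact: bessel1.
pose phi f g := m%:C * ip f g - L2_form f g.
have hphi : hermitian_form phi.
  split=> [a f g h|f g]; rewrite /phi.
    by rewrite (formDl hip) (formDl hB) (formZl hip) (formZl hB); ring.
  rewrite rmorphB rmorphM /= conj_realC.
  by rewrite -(formC hip) -(formC hB).
have qphi f : quad phi f = m * n2 f - q f.
  rewrite -quad_L2_form /quad /phi (quadE hip) -rmorphM.
  by case: (L2_form f f).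
have phi0 f : U f -> 0 <= quad phi f by move=> Uf; rewrite qphi subr_ge0 qm.
have UB f g : U f -> U g -> U (f - g).
  by move=> Uf Ug; rewrite -scaleN1r; apply: UD => //; exact: UZ.
have phif0 : quad phi f0 = 0.
  apply/eqP; rewrite eq_le phi0 // andbT; apply/ler_addgt0Pr => t t0; rewrite add0r.
  have c0 : 0 < 2 + 2 * m by lra.
  have [f [Uf nf qf nt]] := lim0 (t / (2 + 2 * m)) (divr_gt0 t0 c0).
  have := quadD_le hphi (f := f) (g := f0 - f).
  rewrite addrCA subrr addr0 => /(_ (phi0 _ (UB _ _ Uf (UB _ _ Uf0 Uf)))).
  move=> /le_trans; apply.
  have h1 : quad phi f <= t / (2 + 2 * m).
    rewrite qphi; have : m * n2 f <= m by rewrite ler_piMr // ltW.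
    by lra.
  have h2 : quad phi (f0 - f) <= m * (t / (2 + 2 * m)).
    rewrite qphi; apply: (@le_trans _ _ (m * n2 (f0 - f))).
      by rewrite gerBl q_ge0.
    by rewrite ler_pM2l // -(quadN hip) opprB.
  have -> : t = 2 * (t / (2 + 2 * m)) + 2 * (m * (t / (2 + 2 * m))).
    by field; rewrite gt_eqF.
  by rewrite lerD // ler_pM2l.
have qf0 : 0 < q f0.
  (* With [s * (1 + 2 * trace) = m / 4], an approximant within [s] forces [q f0 > 0]. *)
  pose s := m / (4 * (1 + 2 * trace)).
  have tr0 := trace_ge0.
  have s0 : 0 < s by rewrite divr_gt0 // mulr_gt0 //; lra.
  have [f [Uf nf qf nt]] := lim0 s s0.
  have := qD_le f0 (f - f0).
  rewrite addrCA subrr addr0 => h1.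
  have h2 : q (f - f0) <= s * trace.
    apply: (le_trans (q_le_trace _)).
    by rewrite ler_wpM2r.
  have sE : s * (1 + 2 * trace) = m / 4.
    by rewrite /s; field; rewrite gt_eqF //; lra.
  by move: sE; rewrite mulrDr mulr1; lra.
have nf0 : 0 < n2 f0.
  rewrite lt_def ip0 andbT; apply: contraTneq qf0 => nf0.
  by rewrite (n2_eq0 hip ip_normE nf0) q0 ltxx.
have qmf0 : q f0 = m * n2 f0 by move: phif0; rewrite qphi; lra.
(* On the span of the [e i] both sides vanish because the [e i] are eigenvectors orthogonal to [f0];
   on the residual of [g], which lies in [U], [quad_kernel] applies. *)
have Bf0 g : L2_form f0 g = m%:C * ip f0 g.
  rewrite (proj_res ip e N g) (formDr hip) (formDr hB) mulrDr.
  congr (_ + _).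
    rewrite (formC hip (proj ip e N g)) ip_proj_orth // rmorph0 mulr0.
    rewrite (form_sumr hB) big1 // => i _.
    rewrite (formZr hB) (formC hB (e i)) ee (formC hip f0) Uf0 //.
    by rewrite rmorph0 mulr0 rmorph0 mulr0.
  have : phi f0 (res ip e N g) = 0.
    apply: quad_kernel => // c; apply: phi0; apply: UD => //; apply: UZ.
    by move=> i iN; rewrite ip_res.
  by rewrite /phi => /eqP; rewrite subr_eq0 => /eqP <-.
have sf : (Num.sqrt (n2 f0))^-1 ^+ 2 = (n2 f0)^-1 by rewrite exprVn sqr_sqrtr // ltW.
exists ((Num.sqrt (n2 f0))^-1%:C *: f0).
have qh : q ((Num.sqrt (n2 f0))^-1%:C *: f0) = m.
  by rewrite qZ sqn_real sf qmf0 mulrCA mulVf ?mulr1 // gt_eqF.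
split.
- exact: UZ.
- by right; rewrite quadZ // sqn_real sf mulVf // gt_eqF.
- by move=> g; rewrite qh (formZl hB) (formZl hip) Bf0 mulrCA.
- by move=> f Uf; rewrite qh; exact: qm.
Qed.

(** The last clause is the variational characterization of the eigenvalues; it gives their order and
    bounds [q] on the complement of any prefix. *)
Definition eigen_system e := [/\ ortho_system ip e, forall i, eigen (e i) &
  forall N f, (forall i, (i < N)%N -> ip f (e i) = 0) -> q f <= q (e N) * n2 f].

Lemma eigen_system_exists : exists e, eigen_system e.
Proof.
pose Q s h := [/\ orthogonal_to ip s h, h = 0 \/ n2 h = 1, eigen h &
  forall f, orthogonal_to ip s f -> q f <= q h * n2 f].
have [e Qe] : exists e, forall N, Q (mkseq e N) (e N).
  apply: greedy_sequence => [|e N Qe]; first exact: 0.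
  have oe : ortho_system ip (truncate e N).
    by apply: ortho_truncate => // i iN; case: (Qe i iN).
  have ee i : eigen (truncate e N i).
    by rewrite /truncate; case: ltnP => [/Qe[]//|_]; exact: eigen0.
  have [h [hN h1 eh mh]] := max_eigenvector N oe ee.
  exists h; rewrite -(mkseq_truncate e N); split => //.
    exact/orthogonal_mkseq.
  by move=> f /orthogonal_mkseq; exact: mh.
exists e; split => [|i|N f fN].
- by apply: ortho_systemP => // i; case: (Qe i).
- by case: (Qe i).
- by case: (Qe N) => _ _ _; apply; exact/orthogonal_mkseq.
Qed.

Section EigenSystem.
Variable e : nat -> H.
Hypothesis es : eigen_system e.
Let oe : ortho_system ip e. Proof. by case: es. Qed.
Let ee i : eigen (e i). Proof. by case: es. Qed.

Lemma n2_eigen_le1 i : n2 (e i) <= 1.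
Proof. by case: (oe.2 i) => ->; rewrite ?quad0 ?ler01. Qed.

Lemma q_eigen_decr i j : (i <= j)%N -> q (e j) <= q (e i).
Proof.
move=> ij; case: es => _ _ /(_ i (e j)) h; apply: (le_trans (h _)).
  by move=> l li; rewrite oe.1 // gtn_eqF // (leq_trans li).
by rewrite ler_piMr ?q_ge0 // n2_eigen_le1.
Qed.

Lemma L2_form_proj_res N f : L2_form (proj ip e N f) (res ip e N f) = 0.
Proof.
rewrite (form_suml hB) big1 // => i _.
rewrite (formZl hB) ee (formC hip (res ip e N f)) ip_res //.
by rewrite rmorph0 !mulr0.
Qed.

Lemma q_proj N f :
  q (proj ip e N f) = \sum_(i < N) sqn (ip f (e i)) * q (e i).
Proof.
apply: (@complexI R); rewrite -quad_L2_form -(quadE hB).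
rewrite {1}/proj (form_suml hB) rmorph_sum; apply: eq_bigr => i _.
rewrite (formZl hB) ee (formC hip (proj ip e N f)) ip_proj //.
by rewrite rmorphM /= sqnC mulrCA mulrC.
Qed.

Lemma q_split N f : q f = q (proj ip e N f) + q (res ip e N f).
Proof.
rewrite {1}(proj_res ip e N f) -!quad_L2_form (quadD hB) L2_form_proj_res.
by rewrite mulr0 addr0.
Qed.

(** Each [b j] is split along the first [N] eigenvectors. Bessel for [b] bounds the total weight on
    each [e i] by 1, and each residual costs at most [q (e N)]. *)
Lemma sum_q_le_eigen b J N : ortho_system ip b ->
  \sum_(j < J) q (b j) <= \sum_(i < N) q (e i) + J%:R * q (e N).
Proof.
move=> ob.
apply: (@le_trans _ _ (\sum_(j < J) (\sum_(i < N) sqn (ip (b j) (e i)) * q (e i) + q (e N)))).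
  apply: ler_sum => j _; rewrite (q_split N) q_proj lerD2l.
  case: es => _ _ /(_ N (res ip e N (b j))) h; apply: (le_trans (h _)).
    by move=> i iN; rewrite ip_res.
  rewrite ler_piMr ?q_ge0 //; apply: (le_trans (n2_res_le hip oe _ _)).
  by case: (ob.2 j) => ->; rewrite ?quad0 ?ler01.
rewrite big_split /= sumr_const card_ord -[q (e N) *+ _]mulr_natl lerD2r.
rewrite exchange_big /=; apply: ler_sum => i _.
rewrite -mulr_suml ler_piMl ?q_ge0 //.
apply: le_trans (n2_eigen_le1 i); apply: le_trans (bessel hip ip0 ob J (e i)).
by apply: ler_sum => j _; rewrite (formC hip) sqn_conj.
Qed.

(** Take [J] basis vectors that almost exhaust the trace. The eigenvalues decrease and sum to at
    most the trace, so [J * q (e N) <= J * trace / N], which is small for large [N]. *)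
Lemma trace_eigen (eps : R) : 0 < eps ->
  exists N, trace - \sum_(i < N) q (e i) <= eps.
Proof.
move=> eps0; have e20 : 0 < eps / 2 by rewrite divr_gt0.
have [b [ob bb]] := basis_exists.
have [J hJ] := trace_basis ob bb e20.
have tr0 := trace_ge0.
pose N := (Num.truncn (J%:R * trace / (eps / 2))).+1.
have hN : J%:R * trace / (eps / 2) < N%:R.
  by rewrite truncnS_gt.
exists N; have := sum_q_le_eigen J N ob.
have Nq : N%:R * q (e N) <= trace.
  apply: le_trans (sum_q_le_trace N oe).
  rewrite mulr_natl -[X in _ *+ X]card_ord -sumr_const; apply: ler_sum => i _.
  by rewrite q_eigen_decr // ltnW.
suff : J%:R * q (e N) <= eps / 2 by lra.
have N0 : (0 : R) < N%:R by rewrite ltr0n.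
rewrite ltr_pdivrMr // in hN.
rewrite -(ler_pM2l N0) (le_trans _ (ltW hN)) //.
by rewrite mulrCA ler_wpM2l.
Qed.

(** * Comparison with the list of positive eigenvalues *)

Section EigenvalueCount.
Variable lam : nat -> R.
Hypothesis lamP : positive_eigenvalues (Idstar \o Id_rkhs HK) lam.

Lemma adjoint_eigen i : (Idstar \o Id_rkhs HK) (e i) = (q (e i))%:C *: e i.
Proof.
apply/eqP; rewrite -subr_eq0; set w := _ - _.
have wg g : ip w g = 0.
  rewrite /w formBl // formZl //.
  rewrite -[X in X - _]L2_form_adjoint.
  by case: es => _ -> _; rewrite subrr.
by apply/eqP/(n2_eq0 hip ip_normE); rewrite /quad wg.
Qed.

(** The [e i] with value [s] are independent in the kernel of W - s, whose dimension is the number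
    of indices where [lam] equals [s]. Since [lam k.+1 < s], monotonicity places all those indices
    in 1, ..., k. *)
Lemma eigen_count k (s : R) : 0 < s -> lam k.+1 < s ->
  (\sum_(i < k.+1) (q (e i) == s) <= \sum_(j < k) (lam j.+1 == s))%N.
Proof.
move=> s0 ls; case: lamP => lam0 lamD /(_ s s0)[n [v _ Ev] cardn].
apply: (@leq_trans n).
  pose A := [set i : 'I_k.+1 | q (e i) == s]%SET.
  have -> : (\sum_(i < k.+1) (q (e i) == s) = #|A|)%N.
    by rewrite -sum1_card [RHS]big_mkcond; apply: eq_bigr => i _; rewrite inE; case: eqP.
  have qA (i : 'I_#|A|) : q (e (enum_val i)) = s.
    by have := enum_valP i; rewrite inE => /eqP.
  apply: (@lin_indep_le _ _ #|A| n (fun i : 'I_#|A| => e (enum_val i)) v).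
    move=> c c0 i.
    have e1 : n2 (e (enum_val i)) = 1.
      case: (oe.2 (enum_val i)) => // ei; have := qA i.
      by rewrite ei q0 => s00; rewrite -s00 ltxx in s0.
    have := congr1 (fun h => ip h (e (enum_val i))) c0.
    rewrite form_suml // form0l // (bigD1 i) //= big1 => [|j ji].
      by rewrite formZl // quadE // e1 rmorph1 mulr1 addr0.
    rewrite formZl // oe.1 ?mulr0 //.
    by apply: contraNneq ji => /val_inj/enum_val_inj ->.
  move=> i; have : [set f | (Idstar \o Id_rkhs HK) f = s%:C *: f] (e (enum_val i)).
    by rewrite /= -[LHS]/((Idstar \o Id_rkhs HK) _) adjoint_eigen qA.
  by rewrite Ev.
have /card_esym/card_set_bijP[g [gf gi _]] := cardn.
have -> : (\sum_(j < k) (lam j.+1 == s))%N = size [seq j <- iota 1 k | lam j == s].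
  rewrite size_filter -sum1_count [RHS]big_mkcond.
  rewrite -(big_mkord xpredT (fun j => (lam j.+1 == s) : nat)).
  rewrite /index_iota subn0 -[iota 1 k]/(iota (1 + 0) k) iotaDl big_map.
  by apply: eq_bigr => j _; rewrite add1n; case: eqP.
rewrite -[X in (X <= _)%N](size_iota 0) -(size_map g).
apply: uniq_leq_size.
  rewrite map_inj_in_uniq ?iota_uniq // => x y.
  by rewrite !mem_iota /= => xn yn; apply: gi; rewrite inE.
move=> y /mapP[x]; rewrite mem_iota /= => xn ->.
have /= [g1 gs] := gf x xn.
rewrite mem_filter gs eqxx mem_iota g1 /= ltnNge.
apply/negP => kg; have := lamD k.+1 (g x); rewrite kg /= => /(_ isT).
by rewrite gs leNgt ls.
Qed.

(** The shift arises because [e] starts at index 0 and [lam] at 1. Otherwise the values at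
    [e 0, ..., e k] all exceed [lam k.+1], and summing [eigen_count] over the distinct values fits k
    + 1 indices into k places. *)
Lemma eigen_le_lam k : q (e k) <= lam k.+1.
Proof.
have [//|lt_lam] := leP (q (e k)) (lam k.+1).
have qk : 0 < q (e k) by apply: le_lt_trans lt_lam; case: lamP => + _ _; apply.
pose vals := undup [seq q (e (val i)) | i <- enum 'I_k.+1].
have uv : uniq vals by exact: undup_uniq.
suff : (k.+1 <= k)%N by rewrite ltnn.
have E1 : (k.+1 = \sum_(s <- vals) \sum_(i < k.+1) (q (e i) == s))%N.
  rewrite exchange_big /= -[LHS]card_ord -sum1_card; apply: eq_bigr => i _.
  by rewrite sum_uniq_eq // mem_undup (map_f (fun i : 'I_k.+1 => q (e i))) ?mem_enum.
have E2 : (\sum_(s <- vals) \sum_(j < k) (lam j.+1 == s) <= k)%N.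
  rewrite exchange_big /= -[X in (_ <= X)%N]card_ord -sum1_card.
  by apply: leq_sum => j _; rewrite sum_uniq_eq // leq_b1.
rewrite [X in (X <= _)%N]E1; apply: leq_trans E2.
rewrite big_seq [X in (_ <= X)%N]big_seq; apply: leq_sum => s.
rewrite mem_undup => /mapP[i _ ->].
have ik : q (e k) <= q (e i).
  by apply: q_eigen_decr; rewrite -ltnS.
by apply: eigen_count; [exact: lt_le_trans ik|exact: lt_le_trans ik].
Qed.

End EigenvalueCount.

Lemma evZ (a : C) f x : D x -> ev (a *: f) x = a * ev f x.
Proof. by move=> Dx; rewrite !evE // formZl. Qed.

Lemma evB f g x : D x -> ev (f - g) x = ev f x - ev g x.
Proof. by move=> Dx; rewrite !evE // formBl. Qed.

Lemma ev_sum n (F : 'I_n -> H) x : D x -> ev (\sum_i F i) x = \sum_i ev (F i) x.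
Proof.
by move=> Dx; rewrite evE // form_suml //; apply: eq_bigr => i _; rewrite evE.
Qed.

(** * Selection of the sampling points *)

Section SamplingPoints.
Local Open Scope sesquilinear_scope.

Lemma sum_q_tail n M : \sum_(j < M | (n <= j)%N) q (e j) <=
  trace - \sum_(i < n) q (e i).
Proof.
pose S := \sum_(j < M | (n <= j)%N) q (e j).
have [Mn|nM] := leqP M n.
  rewrite big_pred0 ?subr_ge0; first exact: sum_q_le_trace.
  by move=> j; rewrite leqNgt (leq_trans (ltn_ord j)).
rewrite lerBrDr.
apply: le_trans (sum_q_le_trace M oe).
rewrite le_eqVlt; apply/orP; left; apply/eqP.
rewrite -(big_mkord (fun j => (n <= j)%N) (fun j => q (e j))).
rewrite -!(big_mkord xpredT (fun j => q (e j))).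
rewrite [RHS](@big_cat_nat _ _ _ n) //=; last exact: ltnW.
rewrite addrC; congr (_ + _).
rewrite (@big_cat_nat _ _ _ n) //=; last exact: ltnW.
rewrite [X in X + _]big_nat_cond big_pred0 ?add0r; last first.
  by move=> i; case: (leqP n i); rewrite ?andbF // => h; rewrite ltnNge h.
rewrite [LHS]big_nat_cond [RHS]big_nat_cond; apply: eq_bigl => i.
by rewrite andbT; case: (n <= i)%N; rewrite ?andbT ?andbF.
Qed.

(** For the least such [M] a vanishing eigenvalue would allow dropping the last term. Positivity
    permits the later division by [s j]. *)
Lemma positive_prefix (eps : R) : 0 < eps ->
  exists M, trace - \sum_(i < M) q (e i) <= eps /\
    forall j, (j < M)%N -> 0 < q (e j).
Proof.
move=> eps0; have := trace_eigen eps0.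
move=> exM; case: (ex_minnP exM) => M hM minM.
exists M; split => // j jM.
rewrite lt_def q_ge0 andbT; apply/eqP => qj.
have M0 : (0 < M)%N by apply: leq_ltn_trans jM.
have /minM : trace - \sum_(i < M.-1) q (e i) <= eps.
  apply: le_trans hM; rewrite -(prednK M0) big_ord_recr /=.
  suff -> : q (e M.-1) = 0 by rewrite addr0.
  apply/eqP; rewrite eq_le q_ge0 andbT -qj.
  by apply: q_eigen_decr; rewrite -ltnS prednK.
by rewrite leqNgt prednK // leqnn.
Qed.

Lemma sampling_points_exist t0 m n (delta : R) : D t0 -> (16 * n <= m)%N ->
  0 < delta -> exists2 x : 'I_m -> T, forall i, D (x i) &
    forall f, n2 f <= 1 -> (forall i, ev f (x i) = 0) ->
      m%:R / 2 * q f <= 8 * (trace - \sum_(i < n) q (e i)) + delta.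
Proof.
move=> Dt0 nm delta0.
set t := trace - _.
have t_ge0 : 0 <= t.
  by rewrite subr_ge0; exact: sum_q_le_trace.
(* Chosen so that [delta = eps + 5 * eps * m]: the losses are [eps] in [b], [4 * eps * m] at the
   sampling points and [eps * m / 2] in L_2. *)
pose eps := delta / (1 + 5 * m%:R).
have c0 : 0 < 1 + 5 * m%:R :> R by rewrite ltr_pwDl // mulr_ge0.
have eps0 : 0 < eps by rewrite divr_gt0.
have [M [hM qpos]] := positive_prefix eps0.
pose s j : R := Num.sqrt (q (e j)).
have s0 (j : 'I_M) : s j != 0 by rewrite gt_eqF // sqrtr_gt0 qpos.
have ss (j : 'I_M) : s j ^+ 2 = q (e j) by rewrite sqr_sqrtr ?q_ge0.
pose v x : 'rV[C]_M := \row_j ((s j)^-1%:C * ev (e j) x).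
(* The cost of a point is scaled to have integral at most 1/4, strictly below the 1/2 available on
   average. *)
pose r x : R := (4 * eps)^-1 * rest e M x.
have ie0 : 0 < (4 * eps)^-1 by rewrite invr_gt0 mulr_gt0.
have r0 x : D x -> 0 <= r x by move=> _; rewrite mulr_ge0 ?rest_ge0 // ltW.
have avg (P : 'M[C]_M) (l : 'I_M -> R) : P \is unitarymx ->
    2^-1 <= \sum_i l i ->
    exists2 x, D x & r x < \sum_i l i * sqn ((v x *m P ^t*) 0 i).
  move=> uP hl.
  (* The function whose value at [x] is coordinate [i] of [v x] in the basis [P]; unitarity of [P]
     makes its L_2 norm 1. *)
  pose g i := \sum_j ((P i j)^* * (s j)^-1%:C) *: e j.
  have evg i x : D x -> ev (g i) x = (v x *m P ^t*) 0 i.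
    move=> Dx; rewrite ev_sum // mxE; apply: eq_bigr => j _.
    by rewrite evZ // !mxE; ring.
  have qg i : q (g i) = 1.
    have cE j : ip (g i) (e (val j)) = (P i j)^* * (s j)^-1%:C.
      rewrite form_suml // (bigD1 j) //= big1 => [|l' lj].
        have e1 : n2 (e j) = 1.
          case: (oe.2 j) => // ej; have := qpos j (ltn_ord j).
          by rewrite ej q0 ltxx.
        by rewrite formZl // quadE // e1 rmorph1 mulr1 addr0.
      by rewrite formZl // oe.1 ?mulr0.
    have -> : g i = proj ip e M (g i).
      by rewrite {1}/g /proj; apply: eq_bigr => j _; rewrite cE.
    rewrite q_proj.
    have := congr1 (fun A : 'M[C]_M => A i i) (unitarymxP uP).
    rewrite !mxE eqxx => PP; apply: (@complexI R); rewrite rmorph1 -[RHS]PP.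
    rewrite rmorph_sum; apply: eq_bigr => j _.
    rewrite cE sqnM sqn_conj sqn_real exprVn ss -mulrA mulVf ?mulr1.
      by rewrite !mxE; exact: sqnC.
    by rewrite gt_eqF // qpos.
  have key : \int[mu]_(x in D) r x <
      \int[mu]_(x in D) \sum_i l i * sqn (ev (g i) x).
    rewrite Rintegral_sum //; last first.
      by move=> i; apply: intgZl => //; exact: intg_sqn_ev.
    have -> : \sum_i \int[mu]_(x in D) (l i * sqn (ev (g i) x)) = \sum_i l i.
      apply: eq_bigr => i _; rewrite RintegralZl //.
        by rewrite -[X in _ * X]/(q (g i)) qg mulr1.
      exact: intg_sqn_ev.
    rewrite RintegralZl //; last exact: intg_rest.
    rewrite integral_rest //.
    apply: lt_le_trans hl.
    apply: (@le_lt_trans _ _ ((4 * eps)^-1 * eps)); first by rewrite ler_pM2l.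
    by rewrite invfM -mulrA mulVf ?gt_eqF // mulr1 ltf_pV2 ?posrE // ltr_nat.
  apply: contrapT => nex; move: key; rewrite ltNge => /negP; apply.
  apply: le_Rintegral => //.
  - by apply: intg_sum => // i; apply: intgZl => //; exact: intg_sqn_ev.
  - by apply: intgZl => //; exact: intg_rest.
  move=> x Dx; rewrite leNgt; apply/negP => rx; apply: nex; exists x => //.
  by apply: lt_le_trans rx _; apply: ler_sum => i _; rewrite evg.
pose z : R := 8 * n%:R.
(* The summand [eps] keeps [b] positive when [t = 0]. The indices below [n] and the remaining ones
   each contribute at most 1/8 to the initial trace. *)
pose b := 8 * t + eps.
have b0 : 0 < b by rewrite /b ltr_wpDl // mulr_ge0.
pose l0 (j : 'I_M) : R := b / q (e j) + (if (j < n)%N then z else 0).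
have z0 : 0 <= z by rewrite mulr_ge0.
have l00 j : 0 < l0 j.
  by rewrite ltr_pwDl ?divr_gt0 ?qpos //; case: ifP.
have sl0 : \sum_j (l0 j)^-1 <= 4^-1.
  apply: (@le_trans _ _ (\sum_(j < M) ((if (j < n)%N then z^-1 else 0) +
      (if (n <= j)%N then q (e j) / b else 0)))).
    apply: ler_sum => j _; have := l00 j; rewrite /l0; case: (ltnP j n) => jn l0j.
      have z1 : 0 < z by rewrite mulr_gt0 // ltr0n (leq_ltn_trans _ jn).
      by rewrite addr0 lef_pV2 ?posrE // lerDr divr_ge0 ?q_ge0 // ltW.
    by rewrite add0r addr0 invf_div.
  rewrite big_split /= -!big_mkcond /= -mulr_suml.
  have h1 : \sum_(j < M | (j < n)%N) z^-1 <= 8^-1.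
    rewrite sumr_const.
    have cn : (#|[pred j : 'I_M | (j < n)%N]| <= n)%N.
      rewrite cardE -(size_map val) -[X in (_ <= X)%N](size_iota 0).
      apply: uniq_leq_size; first by rewrite (map_inj_uniq val_inj) enum_uniq.
      by move=> i /mapP[j]; rewrite mem_enum inE mem_iota => jn ->.
    have [nE|nN0] := eqVneq n 0%N.
      by rewrite /z nE mulr0 invr0 mul0rn invr_ge0.
    have n0 : 0 < n%:R :> R by rewrite ltr0n lt0n.
    apply: (@le_trans _ _ (z^-1 * n%:R)).
      by rewrite -[leLHS]mulr_natr ler_wpM2l ?invr_ge0 // ler_nat.
    by rewrite /z invfM -mulrA mulVf ?gt_eqF // mulr1.
  have h2 : (\sum_(j < M | (n <= j)%N) q (e j)) / b <= 8^-1.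
    rewrite ler_pdivrMr // (le_trans (sum_q_tail n M)) // -/t /b; lra.
  by apply: (le_trans (lerD h1 h2)); lra.
have [x [w [Dx wr hx]]] := lower_barrier_selection Dt0 r0 avg l00 sl0 m.
exists x => // f nf fx.
pose g := proj ip e M f; pose h := res ip e M f.
have nh : n2 h <= 1 by apply: le_trans nf; exact: n2_res_le.
have fgh : f = g + h by exact: proj_res.
(* The conjugate makes the product of [y] with the adjoint of [v x] equal to the conjugate of
   [ev g x]. *)
pose y : 'rV[C]_M := \row_j (ip f (e j) * (s j)%:C)^*.
have sy j : sqn (y 0 j) = sqn (ip f (e j)) * q (e j).
  by rewrite mxE sqn_conj sqnM sqn_real ss.
have qgE : \sum_j sqn (y 0 j) = q g.
  by rewrite q_proj; apply: eq_bigr => j _.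
have lyE : \sum_j l0 j * sqn (y 0 j) <= b + z * q g.
  rewrite -qgE mulr_sumr.
  apply: (@le_trans _ _ (\sum_(j < M) (b * sqn (ip f (e j)) + z * sqn (y 0 j)))).
    apply: ler_sum => j _; rewrite /l0 mulrDl lerD //.
      rewrite sy le_eqVlt; apply/orP; left; apply/eqP; field.
      by rewrite gt_eqF // qpos.
    by rewrite ler_wpM2r ?sqn_ge0 //; case: ifP.
  rewrite big_split /= lerD2r -mulr_sumr; apply: ler_piMr; first exact: ltW.
  by apply: le_trans nf; apply: bessel.
have evy k : sqn ((y *m (v (x k)) ^t*) 0 0) = sqn (ev g (x k)).
  rewrite -[RHS]sqn_conj; congr sqn.
  rewrite mxE ev_sum // rmorph_sum; apply: eq_bigr => j _.
  rewrite !mxE evZ // -rmorphM; congr (_ ^*).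
  rewrite -mulrA; congr (_ * _); rewrite mulrA -rmorphM /= divff // mul1r //.
have sk : \sum_k w k * sqn ((y *m (v (x k)) ^t*) 0 0) <= 4 * eps * m%:R.
  rewrite mulr_natr -[X in _ *+ X]card_ord -sumr_const; apply: ler_sum => k _.
  have [w0 w1] := wr k.
  rewrite evy.
  (* Since [f = g + h] vanishes at [x k], the truncated part [g] is as small there as the discarded
     part [h]. *)
  have -> : sqn (ev g (x k)) = sqn (ev h (x k)).
    by rewrite /h /res evB // fx sub0r sqnN.
  have hr : sqn (ev h (x k)) <= rest e M (x k).
    apply: (le_trans (sqn_ev_res _ _ oe (Dx k))).
    by rewrite ler_piMl // rest_ge0.
  apply: (@le_trans _ _ (w k * rest e M (x k))); first exact: ler_wpM2l.
  move: w1; rewrite /r mulrCA mulrC -ler_pdivlMr // invrK mul1r //.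
have qh : q h <= eps.
  apply: (le_trans (q_res_le M f oe)).
  apply: le_trans hM; rewrite ler_piMl //.
  by rewrite subr_ge0; exact: sum_q_le_trace.
have := hx y; rewrite qgE => main.
have qf : q f = q g + q h by exact: q_split.
have zm : z <= m%:R / 2.
  rewrite ler_pdivlMr // /z -(ler_nat R) natrM in nm *; lra.
have qg0 : 0 <= q g by exact: q_ge0.
have zq : z * q g <= m%:R / 2 * q g by rewrite ler_wpM2r.
have mq : m%:R / 2 * q h <= m%:R / 2 * eps by rewrite ler_wpM2l // divr_ge0.
have dE : delta = eps + 5 * (eps * m%:R).
  by rewrite /eps; field; rewrite gt_eqF.
have me : 0 <= eps * m%:R by rewrite mulr_ge0 // ltW.
rewrite qf mulrDr dE.
move: main lyE sk zq mq me; rewrite /b.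
set A := m%:R * q g; have -> : m%:R / 2 * q g = A / 2 by rewrite /A; field.
have -> : m%:R / 2 * eps = eps * m%:R / 2 by field.
have -> : 4 * eps * m%:R = 4 * (eps * m%:R) by ring.
lra.
Qed.

End SamplingPoints.

End EigenSystem.

(* The reconstruction picks any element of the unit ball with the given samples;
   it differs from the true one by twice an element of the unit ball that
   vanishes at the sampling points. *)
Lemma sampling_number_le m (x : 'I_m -> T) (y : R) : 0 <= y ->
  (forall i, D (x i)) ->
  (forall f, n2 f <= 1 -> (forall i, ev f (x i) = 0) -> 4 * q f <= y ^+ 2) ->
  (sampling_number mu HK m <= y%:E)%E.
Proof.
move=> y0 Dx small.
pose fit (v : 'rV[C]_m) f := n2 f <= 1 /\ forall i, ev f (x i) = v 0 i.
pose phi (v : 'rV[C]_m) := ev (xget 0 [set f | fit v f]).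
apply: (@le_trans _ _ (worst_case_error mu HK x phi)).
  apply: (@le_trans _ _ (ereal_inf [set worst_case_error mu HK x p
      | p in [set p | forall v, L2 mu D (p v)]])).
    by apply: ereal_inf_lbound; exists x.
  by apply: ereal_inf_lbound; exists phi => // v; exact: L2_ev.
apply: ge_ereal_sup => _ [f /= nf <-].
have nf1 : n2 f <= 1.
  move: nf; rewrite (norm_n2 hip ip_normE) -(rmorph1 (real_complex R)) lecR => nf.
  by rewrite -ler_sqrt // sqrtr1.
rewrite /phi; case: xgetP => [f0 _ [nf0 fit0]|/(_ f)]; last first.
  by case; split => // i; rewrite mxE.
have E : L2_norm mu D (fun t => Id_rkhs HK f t - ev f0 t) = (Num.sqrt (q (f - f0)))%:E.
  rewrite /L2_norm; have -> : (Num.sqrt (q (f - f0)))%:E = sqrte (q (f - f0))%:E by [].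
  rewrite -integral_sqn_ev; congr sqrte.
  by apply: eq_integral => t; rewrite inE => Dt; rewrite evB.
rewrite E lee_fin -[leRHS]ger0_norm // -sqrtr_sqr; apply: ler_wsqrtr.
have h2 : sqn (2^-1)%:C = 4^-1 :> R by rewrite sqn_real; field.
have := small ((2^-1)%:C *: (f - f0)).
rewrite (quadZ hip) qZ h2 mulrA divff // mul1r => small'.
apply: small'.
  rewrite mulrC ler_pdivrMr // mul1r.
  have := quad_parallelogram hip f f0; have := ip0 (f + f0); lra.
by move=> i; rewrite evZ // evB // fit0 mxE subrr mulr0.
Qed.

Lemma sampling_number_ge0 m : (0 <= sampling_number mu HK m)%E.
Proof.
apply: le_ereal_inf_tmp => _ [x Dx <-]; apply: le_ereal_inf_tmp => _ [phi L2phi <-].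
rewrite /worst_case_error; set S := [set _ | _ in _].
apply: (@le_trans _ _ (L2_norm mu D (fun t => Id_rkhs HK 0 t -
    phi (\row_i ev 0 (x i)) t))); first exact: sqrte_ge0.
by apply: ereal_sup_ubound; exists 0 => //=; rewrite normr0.
Qed.

(** The constant is 64 = 4 * 2 * 8: 4 from differences in the unit ball, 2 from the factor [m / 2],
    and 8 from [b]. An arbitrary [eta] absorbs the truncation error. *)
Lemma sampling_number_sqr_le e t0 m n : eigen_system e -> D t0 ->
  (0 < m)%N -> (16 * n <= m)%N ->
  (sampling_number mu HK m ^+ 2 <=
   (64 * (trace - \sum_(i < n) q (e i)) / m%:R)%:E)%E.
Proof.
move=> es Dt0 m0 nm; set t := trace - _.
have oe : ortho_system ip e by case: es.
have t0' : 0 <= t by rewrite subr_ge0; exact: sum_q_le_trace.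
have mR : 0 < m%:R :> R by rewrite ltr0n.
apply/lee_addgt0Pr => eta eta0; rewrite -EFinD.
have [|x Dx hx] := sampling_points_exist es
    (* After multiplication by [8 / m] this contributes exactly [eta]. *)
    (delta := eta * m%:R / 8) Dt0 nm.
  by rewrite divr_gt0 // mulr_gt0.
set Y := _ + eta.
have Y0 : 0 <= Y by rewrite addr_ge0 ?(ltW eta0) // divr_ge0 // mulr_ge0.
have s_le : (sampling_number mu HK m <= (Num.sqrt Y)%:E)%E.
  apply: (sampling_number_le (x := x)) => //.
  move=> f nf fx; rewrite sqr_sqrtr //.
  have := hx f nf fx; rewrite -/t => h.
  rewrite -(ler_pM2l mR) /Y mulrDr [m%:R * (_ / _)]mulrCA divff ?gt_eqF // mulr1.
  by lra.
have s_ge := sampling_number_ge0 m.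
have -> : Y%:E = ((Num.sqrt Y)%:E * (Num.sqrt Y)%:E)%E.
  by rewrite -EFinM -expr2 sqr_sqrtr.
by rewrite expe2; apply: lee_pmul.
Qed.

End Embedding.

(** * Passage to the singular numbers and the stated constants *)

Theorem mainTheorem2 (R : realType) (d : nat)
    (D : set (d.-tuple R)) (mD : measurable D)
    (rho : {measure set (d.-tuple R) -> \bar R})
    (K : d.-tuple R -> d.-tuple R -> R[i]) (psdK : psd_kernel D K)
    (H : completeNormedModType R[i]) (HK : rkhs D K H)
    (sepH : separable H) (infH : infinite_dimensional H)
    (measH : forall f : H, cmeasurable D (rkhs_eval HK f))
    (traceK : (\int[rho]_(x in D) (complex.Re (K x x))%:E < +oo)%E)
    (sigma : nat -> R) (sigmaE : singular_numbers rho HK sigma)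
    (m : nat) (hm : (13 * 10 ^ 3 + 136 <= m)%N) :
  let C : R := 15 / 10 * 10 ^+ 6 in
  let c : R := 38 / 10 * 10 ^- 5 in
  (sampling_number rho HK m ^+ 2 <=
   (C * (ln m%:R / m%:R))%:E *
   \sum_(1 <= k <oo | (c * m%:R <= k%:R)%R) ((sigma k ^+ 2)%R)%:E)%E.
Proof.
cbv zeta; set C : R := 15 / 10 * 10 ^+ 6; set c : R := 38 / 10 * 10 ^- 5.
have [Idstar [lam [adjI lamP sigma_lam]]] := sigmaE.
(* On an empty [D] every element of [H] would be 0, contradicting the existence of an independent
   vector. *)
have [t0 Dt0] : exists t, D t.
  apply: contrapT => nD.
  have [v iv] := infH 1%N.
  have v0 : v ord0 = 0 by apply: (@rkhs_eval_inj _ _ _ _ _ HK) => x Dx; case: nD; exists x.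
  have := iv (fun=> 1) _ ord0; rewrite big_ord1 v0 scaler0 => /(_ erefl) /eqP.
  by rewrite oner_eq0.
have [e es] := eigen_system_exists mD sepH measH traceK adjI.
have m0 : (0 < m)%N by apply: leq_trans hm.
have mR : 0 < m%:R :> R by rewrite ltr0n.
pose n := (m %/ 16)%N.
have nm : (16 * n <= m)%N by rewrite mulnC leq_trunc_div.
have := sampling_number_sqr_le mD sepH measH traceK adjI es Dt0 m0 nm.
set t := trace rho HK - _ => /le_trans; apply.
set S := (\sum_(1 <= k <oo | _) _)%E.
(* Up to [eps], [t] is a finite sum of eigenvalues with index at least [n]; each is bounded by the
   squared singular number of the next index, which exceeds [n]. *)
have tS : (t%:E <= S)%E.
  apply/lee_addgt0Pr => eps eps0.
  have [M hM] := trace_eigen mD sepH measH traceK adjI es eps0.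
  apply: (@le_trans _ _ ((\sum_(n <= j < maxn n M) sigma j.+1 ^+ 2 + eps)%:E)).
    rewrite lee_fin /t.
    have : \sum_(i < M) q rho HK (e i) <= \sum_(i < maxn n M) q rho HK (e i).
      rewrite -!(big_mkord xpredT (fun j => q rho HK (e j))).
      rewrite [leRHS](@big_cat_nat _ _ _ M) ?leq_maxr //= lerDl.
      by apply: sumr_ge0 => i _; exact: q_ge0.
    rewrite -!(big_mkord xpredT (fun j => q rho HK (e j))).
    rewrite [leRHS](@big_cat_nat _ _ _ n) ?leq_maxl //=.
    have : \sum_(n <= j < maxn n M) q rho HK (e j) <=
        \sum_(n <= j < maxn n M) sigma j.+1 ^+ 2.
      apply: ler_sum => j _; rewrite sigma_lam // sqr_sqrtr.
        exact: (eigen_le_lam mD sepH measH traceK adjI es lamP).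
      by case: lamP => + _ _; apply.
    by rewrite -(big_mkord xpredT (fun j => q rho HK (e j))) in hM; lra.
  rewrite EFinD leeD2r // -sumEFin.
  apply: le_trans (nneseries_lim_ge (maxn n M).+1 _); last first.
    by move=> k _ _; rewrite lee_fin sqr_ge0.
  have -> : (\sum_(n <= j < maxn n M) (sigma j.+1 ^+ 2)%:E =
      \sum_(n.+1 <= j < (maxn n M).+1) (sigma j ^+ 2)%:E)%E.
    by rewrite big_add1.
  rewrite [leRHS](@big_cat_nat _ _ _ n.+1) //=; last by rewrite ltnS leq_maxl.
  apply: (@le_trans _ _ (\sum_(n.+1 <= j < (maxn n M).+1 | (c * m%:R <= j%:R)%R)
      (sigma j ^+ 2)%:E)%E); last first.
    by apply: leeDr; apply: sume_ge0 => k _; rewrite lee_fin sqr_ge0.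
  rewrite le_eqVlt; apply/orP; left; apply/eqP.
  rewrite [LHS]big_nat_cond [RHS]big_nat_cond; apply: eq_bigl => k.
  rewrite andbT; case: (ltnP n k) => //= nk; case: (k < _)%N => //=; apply/esym.
  (* As [n] is the integer part of [m / 16], [k > n] gives [m <= 16 * k], and [16 * c <= 1] then
     yields [c * m <= k]. *)
  have mk : m%:R <= 16 * k%:R :> R.
    rewrite -natrM ler_nat.
    have := ltn_ceil m (ltn0Sn 15); rewrite mulnC -/n => /ltnW /leq_trans; apply.
    by rewrite leq_mul2l nk orbT.
  have c16 : c * 16 <= 1 by rewrite /c; lra.
  apply: (@le_trans _ _ (c * (16 * k%:R))); last by rewrite mulrA ler_piMl.
  by rewrite ler_wpM2l // /c; lra.
(* The bound [64 * t / m] has no logarithm, so [ln m >= 1/2] and [C >= 128] suffice; the former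
   follows from [ln (1 / m) <= 1 / m - 1]. *)
have lnm : 2^-1 <= ln m%:R :> R.
  have -> : ln m%:R = - ln (m%:R^-1) :> R by rewrite lnV ?posrE // opprK.
  have im : m%:R^-1 <= 2^-1 :> R.
    by rewrite lef_pV2 ?posrE // ler_nat (leq_trans _ hm).
  have im0 : 0 < m%:R^-1 :> R by rewrite invr_gt0.
  have := @le_ln1Dx R (m%:R^-1 - 1); rewrite addrCA subrr addr0; lra.
have C64 : 64 <= C * ln m%:R.
  have C128 : 128 <= C by rewrite /C; lra.
  apply: (@le_trans _ _ (128 * ln m%:R)); first by lra.
  by rewrite ler_wpM2r //; lra.
have t_ge0 : 0 <= t.
  by rewrite subr_ge0; case: es => oe _ _; exact: (sum_q_le_trace mD sepH measH traceK).
apply: (@le_trans _ _ ((C * (ln m%:R / m%:R))%:E * t%:E)%E).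
  rewrite -EFinM lee_fin mulrAC !mulrA ler_wpM2r ?invr_ge0 //.
  by rewrite ler_wpM2r.
apply: lee_wpmul2l => //; rewrite lee_fin mulrA divr_ge0 //; lra.
Qed.
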